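(* For any $0\le s\le t$ and any $Y\in\mathbb H_s(\mathbb R^d)$ we have $$-\int_s^t\gamma\left(-\partial B_u(\psi_{s,u}(Y))\right)du\;\le\;\log\left|\!\left|\!\left|\partial\psi_{s,t}(Y)\right|\!\right|\!\right|_{\mathbb H_s(\mathbb R^d)\to\mathbb H_t(\mathbb R^d)}\;\le\;\int_s^t\gamma\left(\partial B_u(\psi_{s,u}(Y))\right)du .$$ In addition, condition $(H)$ (with parameter $\lambda_0>0$) implies that $\partial B_t(X)_{sym}\le-\lambda_0 I$ for all $t\ge0$ and $X\in\mathbb H_t(\mathbb R^d)$, and this latter property implies that for all $0\le s\le t$ and $Y\in\mathbb H_s(\mathbb R^d)$ $$\log\left|\!\left|\!\left|\partial\psi_{s,t}(Y)\right|\!\right|\!\right|_{\mathbb H_s(\mathbb R^d)\to\mathbb H_t(\mathbb R^d)}\le-\lambda_0\,(t-s).$$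
   Context: **Model.** Fix $d\ge1$. $P_n(\mathbb R^d)$ is the set of probability measures on $\mathbb R^d$ with finite absolute $n$-th moment. $b_t:\mathbb R^{2d}\to\mathbb R^d$, $(x_1,x_2)\mapsto b_t(x_1,x_2)$, $t\ge0$, is differentiable at any order with uniformly bounded derivatives. A prime denotes transposition. For a vector valued function $h$, $\nabla h$ is the matrix $(\nabla h)_{k,i}=\partial_{x^k}h^i$; $b^{[i]}_t:=\nabla_{x_i}b_t$, $i=1,2$, and $\|b^{[2]}\|_2:=\sup_{t,x_1,x_2}\|b_t^{[2]}(x_1,x_2)\|_2<\infty$ (spectral norm). $W_t$ is a $d$-dimensional Brownian motion on a filtered probability space $(\Omega,(\mathbb F_t)_{t\ge0},\mathbb P)$. For $\mu\in P_2(\mathbb R^d)$, $X^\mu_{s,t}(x)$ is the stochastic flow of the McKean-Vlasov equation $dX^\mu_{s,t}(x)=b_t(X^\mu_{s,t}(x),\phi_{s,t}(\mu))dt+dW_t$, $X^\mu_{s,s}(x)=x$, where $b_t(x,\eta):=\int\eta(dy)b_t(x,y)$ and $\phi_{s,t}(\mu)(dy)=\int\mu(dx)\,\mathbb P(X^\mu_{s,t}(x)\in dy)$. **Hilbert space formulation.** $\mathbb H_t(\mathbb R^d):=\mathbb L_2((\Omega,\mathbb F_t,\mathbb P),\mathbb R^d)$ with its $\mathbb L_2$ inner product (the space is assumed to contain square integrable variables independent of the Brownian motion). For $Y\in\mathbb H_s(\mathbb R^d)$ with law $\mu$, $\psi_{s,t}(Y):=X^\mu_{s,t}(Y)$, which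 solves $d\psi_{s,t}(Y)=B_t(\psi_{s,t}(Y))dt+dW_t$ with $B_t(X):=\mathbb E(b_t(X,\overline X)\,|\,X)$, $\overline X$ an independent copy of $X$. The differential $\partial B_t(X)$ is the bounded linear operator on $\mathbb H_t(\mathbb R^d)$ given by $$\partial B_t(X)\cdot Z=\mathbb E\left(b^{[1]}_t(X,\overline X)'Z+b_t^{[2]}(X,\overline X)'\overline Z\,\middle|\,\mathbb F_t\right),$$ with $(\overline X,\overline Z)$ an independent copy of $(X,Z)$. The tangent process $\partial\psi_{s,t}(Y)\in \mathrm{Lin}(\mathbb H_s(\mathbb R^d),\mathbb H_t(\mathbb R^d))$, also denoted $e^{\oint_s^t\partial B_u(\psi_{s,u}(Y))du}$, is the propagator of the linear equation $\partial_t(\partial\psi_{s,t}(Y)\cdot U)=\partial B_t(\psi_{s,t}(Y))\cdot(\partial\psi_{s,t}(Y)\cdot U)$, $\partial\psi_{s,s}(Y)\cdot U=U$, for $U\in\mathbb H_s(\mathbb R^d)$. $|||\cdot|||$ is the operator norm. For a bounded operator $T$ on $\mathbb H_t(\mathbb R^d)$ with adjoint $T^\star$, $T_{sym}:=(T+T^\star)/2$, $\gamma(T):=\sup_{\|Z\|_{\mathbb H_t(\mathbb R^d)}=1}\langle Z,T_{sym}\cdot Z\rangle_{\mathbb H_t(\mathbb R^d)}$, and $T_{sym}\le-\lambda_0I$ means $\gamma(T)\le-\lambda_0$. **Condition $(H)$.** There exist $\lambda_0>0$ and $\lambda_1>\|b^{[2]}\|_2$ such that for all $(x_1,x_2)\in\mathbb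 R^{2d}$, $t\ge0$: $A_t(x_1,x_2)_{sym}\le-\lambda_0I$ and $b^{[1]}_t(x_1,x_2)_{sym}\le-\lambda_1I$, where $A_t(x_1,x_2):=\begin{pmatrix}b_t^{[1]}(x_1,x_2)&b_t^{[2]}(x_2,x_1)\\ b_t^{[2]}(x_1,x_2)&b_t^{[1]}(x_2,x_1)\end{pmatrix}$ and $A_{sym}=(A+A')/2$ for a matrix $A$. *)

(* Defs.v *)
From HB Require Import structures.
From mathcomp Require Import all_boot all_order all_algebra.
From mathcomp Require Import all_classical all_reals all_analysis.

Set Implicit Arguments.
Unset Strict Implicit.
Unset Printing Implicit Defensive.

Import Order.TTheory GRing.Theory Num.Theory.
Import numFieldNormedType.Exports.

Local Open Scope classical_set_scope.
Local Open Scope ring_scope.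

(* Vectors of R^d are rows. The library's [jacobian h x] has (k, i) entry the
   k-th partial derivative of the i-th component of h, so it is exactly the
   gradient matrix nabla h, and the column vector (nabla h)' z corresponds to
   the row vector z *m jacobian h x. *)

Section matrices.
Context {R : realType}.

Definition dotv {n} (u v : 'rV[R]_n) : R := (u *m v^T) 0 0.

Definition enorm {n} (u : 'rV[R]_n) : R := Num.sqrt (dotv u u).

Definition mxsym {n} (A : 'M[R]_n) : 'M[R]_n := 2^-1 *: (A + A^T).

Definition loewner_le {n} (A B : 'M[R]_n) : Prop :=
  forall z : 'rV[R]_n, dotv (z *m A) z <= dotv (z *m B) z.

(* z *m A^T is the transpose of the column A z'. *)
Definition spectral_norm {n} (A : 'M[R]_n) : \bar R :=
  ereal_sup [set (enorm (z *m A^T))%:E | z in [set z : 'rV[R]_n | enorm z = 1]].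

End matrices.

Section drift.
Context {R : realType} {d : nat}.
Local Notation Rd := 'rV[R]_d.
Variable b : R -> Rd * Rd -> Rd.

Fixpoint iter_derive {V W : normedModType R} (f : V -> W) (vs : seq V) : V -> W :=
  if vs is v :: vs' then fun x => 'D_v (iter_derive f vs') x else f.

(* The bounds concern derivatives of order at least one and are uniform in time
   and space; b itself may be unbounded, and no regularity in time is imposed. *)
Definition smooth_bounded_derivatives : Prop :=
  (forall (t : R) vs z, 0 <= t -> differentiable (iter_derive (b t) vs) z) /\
  (forall vs, vs != [::] ->
     exists C : R, forall (t : R) z, 0 <= t -> `|iter_derive (b t) vs z| <= C).

Definition grad1 (t : R) (x1 x2 : Rd) : 'M[R]_d :=
  jacobian (fun y : Rd => b t (y, x2)) x1.

Definition grad2 (t : R) (x1 x2 : Rd) : 'M[R]_d :=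
  jacobian (fun y : Rd => b t (x1, y)) x2.

Definition grad2_norm : \bar R :=
  ereal_sup [set y | exists (t : R) x1 x2, 0 <= t /\ y = spectral_norm (grad2 t x1 x2)].

Definition Amx (t : R) (x1 x2 : Rd) : 'M[R]_(d + d) :=
  block_mx (grad1 t x1 x2) (grad2 t x2 x1)
           (grad2 t x1 x2) (grad1 t x2 x1).

Definition condH (lambda0 : R) : Prop :=
  0 < lambda0 /\
  exists lambda1 : R, (grad2_norm < lambda1%:E)%E /\
    forall (t : R) x1 x2, 0 <= t ->
      loewner_le (mxsym (Amx t x1 x2)) (- lambda0)%:M /\
      loewner_le (mxsym (grad1 t x1 x2)) (- lambda1)%:M.

End drift.

(* R^d with its Borel sigma-algebra. *)
Definition borel_rV (R : realType) (d : nat) :=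
  g_sigma_algebraType (@open 'rV[R]_d).

Section measures_rV.
Context {R : realType} {d : nat}.
Local Notation Rd := 'rV[R]_d.

Definition measurable_wrt {T : Type} (G : set (set T)) (f : T -> Rd) : Prop :=
  forall B : set (borel_rV R d), measurable B -> G (f @^-1` B).

Definition P2 (eta : probability (borel_rV R d) R) : Prop :=
  (\int[eta]_y (enorm (y : Rd) ^+ 2)%:E < +oo)%E.

Definition mean_drift (b : R -> Rd * Rd -> Rd) (t : R) (x : Rd)
    (eta : probability (borel_rV R d) R) : Rd :=
  \row_i \int[eta]_y (b t (x, (y : Rd)) 0 i).

(* g is a version of the conditional expectation of f given the
   sub-sigma-algebra G. *)
Definition is_condexp {dT} {T : measurableType dT}
    (Q : {measure set T -> \bar R}) (G : set (set T)) (f g : T -> Rd) : Prop :=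
  [/\ measurable_wrt G g,
      forall i, Q.-integrable setT (fun x => (f x 0 i)%:E),
      forall i, Q.-integrable setT (fun x => (g x 0 i)%:E) &
      forall A, G A -> forall i,
        (\int[Q]_(x in A) (g x 0 i)%:E = \int[Q]_(x in A) (f x 0 i)%:E)%E].

End measures_rV.

Section law.
Context {R : realType} {d : nat} {dO : measure_display} {Omega : measurableType dO}.
Variable P : probability Omega R.

Definition law (Y : Omega -> borel_rV R d) : probability (borel_rV R d) R :=
  match pselect (measurable_fun setT Y) with
  | left mY =>
      distribution P
        (HB.pack_for {mfun Omega >-> borel_rV R d} Y
           (isMeasurableFun.Build _ _ _ _ Y mY))
  | right _ => dirac (point : borel_rV R d)
  end.

End law.

Section filtered_space.
Context {R : realType} {d : nat} {dO : measure_display} {Omega : measurableType dO}.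
Variables (P : probability Omega R) (F : R -> set (set Omega)).
Local Notation Rd := 'rV[R]_d.

Definition filtration : Prop :=
  (forall t : R, 0 <= t -> sigma_algebra setT (F t) /\ F t `<=` measurable) /\
  (forall s t : R, 0 <= s -> s <= t -> F s `<=` F t).

Definition independent (G1 G2 : set (set Omega)) : Prop :=
  forall A B, G1 A -> G2 B -> (P (A `&` B) = P A * P B)%E.

Definition sigma_rv (f : Omega -> Rd) : set (set Omega) :=
  [set f @^-1` B | B in (measurable : set (set (borel_rV R d)))].

Definition sigma_process (W : R -> Omega -> Rd) : set (set Omega) :=
  <<s \bigcup_(t in [set t : R | 0 <= t]) sigma_rv (W t) >>.

Record brownian_motion (W : R -> Omega -> Rd) : Prop := {
  bm_start : {ae P, forall w, W 0 w = 0} ;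
  bm_adapted : forall t : R, 0 <= t -> measurable_wrt (F t) (W t) ;
  bm_continuous :
    {ae P, forall w, {within `[0, +oo[, continuous (fun t => W t w)}} ;
  bm_independent : forall s t : R, 0 <= s -> s <= t ->
    independent (F s) (sigma_rv (fun w => W t w - W s w)) ;
  bm_gaussian : forall s t : R, 0 <= s -> s < t ->
    forall B : 'I_d -> set R, (forall i, measurable (B i)) ->
      P [set w | forall i, B i ((W t w - W s w) 0 i)] =
      (\prod_(i < d) normal_prob 0%R (Num.sqrt (t - s)%R) (B i))%E }.

(* The Hilbert space of square integrable F_t-measurable vectors. Its elements
   are represented by functions, and everything below is invariant under
   almost sure equality. *)
Definition inH (t : R) (Z : Omega -> Rd) : Prop :=
  measurable_wrt (F t) Z /\ (\int[P]_w (enorm (Z w) ^+ 2)%:E < +oo)%E.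

Definition hdot (Z V : Omega -> Rd) : R := \int[P]_w dotv (Z w) (V w).

Definition hnorm (Z : Omega -> Rd) : R := Num.sqrt (hdot Z Z).

Definition is_adjoint (t : R) (T S : (Omega -> Rd) -> (Omega -> Rd)) : Prop :=
  (forall Z, inH t Z -> inH t (S Z)) /\
  (forall Z V, inH t Z -> inH t V -> hdot (T Z) V = hdot Z (S V)).

(* The adjoint is unique up to almost sure equality on the elements of H_t; the
   default value is irrelevant for bounded operators. *)
Definition adjoint (t : R) (T : (Omega -> Rd) -> (Omega -> Rd)) :
    (Omega -> Rd) -> (Omega -> Rd) :=
  xget T [set S | is_adjoint t T S].

Definition opsym (t : R) (T : (Omega -> Rd) -> (Omega -> Rd)) :
    (Omega -> Rd) -> (Omega -> Rd) :=
  fun Z w => 2^-1 *: (T Z w + adjoint t T Z w).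

Definition opopp (T : (Omega -> Rd) -> (Omega -> Rd)) :
    (Omega -> Rd) -> (Omega -> Rd) :=
  fun Z w => - T Z w.

Definition gamma (t : R) (T : (Omega -> Rd) -> (Omega -> Rd)) : \bar R :=
  ereal_sup [set (hdot Z (opsym t T Z))%:E | Z in
    [set Z | inH t Z /\ hnorm Z = 1]].

Definition opnorm (s : R) (T : (Omega -> Rd) -> (Omega -> Rd)) : \bar R :=
  ereal_sup [set (hnorm (T U))%:E | U in [set U | inH s U /\ hnorm U <= 1]].

(* The space contains genuinely random square integrable variables independent
   of the Brownian motion. *)
Definition contains_independent_variables (W : R -> Omega -> Rd) : Prop :=
  exists Y, [/\ inH 0 Y,
    ~ (exists c, {ae P, forall w, Y w = c}) &
    independent (sigma_rv Y) (sigma_process W)].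

Variable b : R -> Rd * Rd -> Rd.

(* An independent copy of (X, Z) is realized on the product space
   (Omega * Omega, P \x P): X and Z read the first coordinate, their copies read
   the second one, and F_t is identified with the sets A x Omega, A in F_t. *)
Definition is_dB (t : R) (X Z V : Omega -> Rd) : Prop :=
  is_condexp (P \x P)%E [set A `*` setT | A in F t]
    (fun w => Z w.1 *m grad1 b t (X w.1) (X w.2) +
              Z w.2 *m grad2 b t (X w.1) (X w.2))
    (fun w => V w.1).

Definition dB (t : R) (X Z : Omega -> Rd) : Omega -> Rd :=
  xget (fun=> 0) [set V | is_dB t X Z V].

Section flow.
Variables (W : R -> Omega -> Rd).
Variables
  (X : R -> R -> probability (borel_rV R d) R -> Rd -> Omega -> Rd)
  (phi : R -> R -> probability (borel_rV R d) R -> probability (borel_rV R d) R).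

(* [X s t mu x] is the flow started at x at time s, and [phi s t mu] the law at
   time t of the flow started at time s from a variable of law mu. The noise is
   additive, so the stochastic equation is understood in its integral form,
   without any stochastic integral. *)
Record mckean_vlasov_flow : Prop := {
  flow_P2 : forall (s t : R) mu, 0 <= s -> s <= t -> P2 mu -> P2 (phi s t mu) ;
  flow_measurable : forall (s t : R) mu, 0 <= s -> s <= t -> P2 mu ->
    measurable_wrt
      <<s [set U `*` A | U in (measurable : set (set (borel_rV R d))) & A in F t] >>
      (fun xw : Rd * Omega => X s t mu xw.1 xw.2) ;
  flow_law : forall (s t : R) mu, 0 <= s -> s <= t -> P2 mu ->
    forall A : set (borel_rV R d), measurable A ->
      (phi s t mu A = \int[mu]_x P (X s t mu x @^-1` A))%E ;
  flow_equation : forall (s : R) mu, 0 <= s -> P2 mu ->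
    {ae P, forall w, forall (x : Rd) t, s <= t ->
      (forall i, lebesgue_measure.-integrable `[s, t]
        (fun u => (mean_drift b u (X s u mu x w) (phi s u mu) 0 i)%:E)) /\
      X s t mu x w =
        x + \row_i (\int[lebesgue_measure]_(u in `[s, t])
                      mean_drift b u (X s u mu x w) (phi s u mu) 0 i)
          + (W t w - W s w)} }.

Definition psi (s t : R) (Y : Omega -> Rd) : Omega -> Rd :=
  fun w => X s t (law P Y) (Y w) w.

(* [Dpsi s t Y U] stands for the tangent process at Y applied to U; the time
   derivative is taken in the L2 norm, one-sided at time s. *)
Record tangent_process
    (Dpsi : R -> R -> (Omega -> Rd) -> (Omega -> Rd) -> (Omega -> Rd)) : Prop := {
  tangent_inH : forall (s t : R) Y U, 0 <= s -> s <= t -> inH s Y -> inH s U ->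
    inH t (Dpsi s t Y U) ;
  tangent_start : forall (s : R) Y U, 0 <= s -> inH s Y -> inH s U ->
    {ae P, forall w, Dpsi s s Y U w = U w} ;
  tangent_equation : forall (s t : R) Y U, 0 <= s -> s <= t -> inH s Y -> inH s U ->
    hnorm (fun w => (r - t)^-1 *: (Dpsi s r Y U w - Dpsi s t Y U w)
                    - dB t (psi s t Y) (Dpsi s t Y U) w)
      @[r --> within [set r | s <= r] t^'] --> (0 : R) }.

End flow.

End filtered_space.

(* Main.v *)
Require Import Defs.
From HB Require Import structures.
From mathcomp Require Import all_boot all_order all_algebra.
From mathcomp Require Import all_classical all_reals all_analysis.
From mathcomp Require Import measurable_realfun.
From mathcomp Require Import lra ring.

Import Order.TTheory GRing.Theory Num.Theory.
Import numFieldNormedType.Exports.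

Local Open Scope classical_set_scope.
Local Open Scope ring_scope.

(** Write [U_t] for the tangent process started from [U] and [T_t] for the
    differential of the drift at the flow. The process is differentiable in
    quadratic mean with derivative [T_t U_t], so [f t := |U_t|^2] has derivative
    [2 <U_t, T_t U_t>], and this is bounded by a multiple of [f] because the
    gradients of [b] are bounded. Hence [f] either vanishes identically or stays
    positive, and [ln |U_t| - ln |U_s|] is the integral of the Rayleigh quotient
    [<U_u, T_u U_u> / |U_u|^2], which lies between [- gamma (- T_u)] and
    [gamma T_u] ([tangent_growth]). Taking the supremum over [U], or one unit
    vector [U], gives the two bounds on the logarithm of the operator norm.

    Three points carry the details. First, [b] has no regularity in time, so [f']
    may be discontinuous and [u |-> gamma T_u] may fail to be measurable. The
    fundamental theorem of calculus is therefore proved for everywhere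
    differentiable functions with a bounded derivative
    ([bounded_derivative_FTC]), and the comparison with [gamma] only uses that
    the integral is monotone on arbitrary functions ([integral_le_any]): the
    Rayleigh quotient is a measurable minorant.

    Second, [T_t] is a conditional expectation on the product space. It exists,
    being the integral over the second copy, and it is almost surely unique, so
    that [<Z, T_t Z>] is the integral over the product space of a quadratic form
    in the pair formed by [Z] and its independent copy ([dB_spec]). Exchanging
    the two copies and averaging turns this form into the one of the matrix [A_t]
    evaluated at the pair, whence [<Z, T_t Z> <= - lambda0 |Z|^2] under (H)
    ([condH_gamma]). The symmetric part of [T_t] enters only through its
    quadratic form, which is the one of [T_t] itself ([hdot_opsym]).

    Third, a bound on [gamma] at the square integrable points of the space
    extends to all [F_t]-measurable points by truncation, since the gradients
    are bounded and continuous ([truncation_gamma]). It therefore holds along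
    the flow, of which only the measurability is established
    ([psi_measurable]), and the last claim follows from the upper bound. *)

(** * Integration of bounded derivatives *)

(** The integral of a nonnegative function is a supremum over the simple functions
    below it, so it is monotone on arbitrary functions. This is what allows a
    comparison with [gamma], an uncountable supremum at each time. *)
Lemma integral_le_any {dT} {T : measurableType dT} {R : realType}
    (mu : {measure set T -> \bar R}) (D : set T) (f g : T -> \bar R) :
  (forall x, D x -> (f x <= g x)%E) ->
  (\int[mu]_(x in D) f x <= \int[mu]_(x in D) g x)%E.
Proof.
move=> fg.
have mono (f1 f2 : T -> \bar R) :
    (forall x, (0 <= f1 x)%E) -> (forall x, (f1 x <= f2 x)%E) ->
    (\int[mu]_x f1 x <= \int[mu]_x f2 x)%E.
  move=> f10 f12; rewrite !ge0_integralTE//; last first.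
    by move=> x; exact: le_trans (f12 x).
  by apply: ereal_sup_le => _ [h hf1 <-]; exists h => // x; exact: le_trans (f12 x).
rewrite integral_mkcond [leRHS]integral_mkcond integralE [leRHS]integralE.
have le_res x : ((f \_ D) x <= (g \_ D) x)%E.
  by rewrite !patchE; case: ifPn => // /[!inE]; exact: fg.
apply: leeB; apply: mono => // x.
- exact: (@funepos_le _ _ setT) (mem_setT _).
- exact: (@funeneg_le _ _ setT) (mem_setT _).
Qed.

Section bounded_derivative.
Context {R : realType}.
Local Notation mu := (@lebesgue_measure R).

Definition clamp (s t x : R) : R := Num.max s (Num.min t x).

Lemma clamp_id s t x : s <= x <= t -> clamp s t x = x.
Proof. by move=> /andP[sx xt]; rewrite /clamp min_r// max_r. Qed.

Lemma clamp_itv s t x : s <= t -> s <= clamp s t x <= t.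
Proof. by move=> st; rewrite /clamp le_max lexx ge_max st/= ge_min lexx. Qed.

Lemma clamp_lip s t x y : `|clamp s t x - clamp s t y| <= `|x - y|.
Proof.
rewrite /clamp; case: (leP t x) => ?; case: (leP t y) => ?; case: (leP s t) => ?;
  try (case: (leP s x) => ?); try (case: (leP s y) => ?); rewrite ?subrr ?normr0 //;
  rewrite ler_norml; have := ler_norm (x - y); have := ler_norm (- (x - y)); rewrite normrN; lra.
Qed.

Lemma bounded_derivative_lipschitz (g Dg : R -> R) s t K :
  {within `[s, t], continuous g} ->
  (forall u, u \in `]s, t[ -> is_derive u 1 g (Dg u)) ->
  (forall u, u \in `]s, t[ -> `|Dg u| <= K) ->
  forall x y, s <= x -> x <= y -> y <= t -> `|g y - g x| <= K * (y - x).
Proof.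
move=> cg dg Kg x y sx + yt; rewrite le_eqVlt => /predU1P[->|xy].
  by rewrite !subrr normr0 mulr0.
have sub : `]x, y[ `<=` `]s, t[ by apply: subset_itv; rewrite bnd_simp.
have dg' z : z \in `]x, y[ -> is_derive z 1 g (Dg z).
  by move=> zxy; apply: dg; exact: sub.
have cg' : {within `[x, y], continuous g}.
  by apply: continuous_subspaceW cg; apply: subset_itv; rewrite bnd_simp.
have [c cxy ->] := MVT xy dg' cg'.
have yx0 : 0 <= y - x by rewrite subr_ge0 ltW.
rewrite normrM (ger0_norm yx0).
by rewrite ler_wpM2r// Kg//; exact: sub.
Qed.

Lemma is_derive_harmonic_quotient (h : R -> R) (x l : R) : is_derive x 1 h l ->
  n.+1%:R * (h (x + n.+1%:R^-1) - h x) @[n --> \oo] --> l.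
Proof.
move=> [dh <-].
have dh' : (fun e => e^-1 *: ((h \o shift x) (e *: 1) - h x)) e @[e --> 0^'] --> 'D_1 h x.
  exact: dh.
move/cvgr_dnbhsP : dh' => /(_ (@harmonic R)) /=; rewrite /harmonic.
have -> : (fun n : nat => n.+1%:R * (h (x + n.+1%:R^-1) - h x)) =
    (fun n : nat => n.+1%:R^-1^-1 *: (h (n.+1%:R^-1 *: 1 + x) - h x)).
  by apply/funext => n; rewrite /harmonic/= invrK scaler1 [_ + x]addrC.
by apply; split; [move=> n; rewrite gt_eqF// invr_gt0|exact: cvg_harmonic].
Qed.

(** The difference quotients of [g] with step [1 / (n + 1)] are dominated by [K] and
    converge to [Dg], so their integrals converge to that of [Dg]. They are also
    the derivatives of the difference quotients of an antiderivative [G] of [g],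
    so these integrals are increments of the latter quotients, which converge to
    the increment of [G' = g]. *)
Lemma bounded_derivative_FTC (g Dg : R -> R) (s t K : R) : s < t ->
  {within `[s, t], continuous g} ->
  (forall u, u \in `]s, t[ -> is_derive u 1 g (Dg u)) ->
  (forall u, u \in `]s, t[ -> `|Dg u| <= K) ->
  (\int[mu]_(u in `[s, t]) (Dg u)%:E)%E = (g t - g s)%:E.
Proof.
move=> st cg dg Kg.
have K0 : 0 <= K.
  by apply: le_trans (Kg ((s + t) / 2) _) => //; rewrite in_itv/=; lra.
(* [g] is extended by its end values, so that shifted arguments make sense *)
pose gx x := g (clamp s t x).
have gxlip x y : `|gx x - gx y| <= K * `|x - y|.
  wlog xy : x y / x <= y.
    move=> h; have [xy|/ltW yx] := leP x y; first exact: h.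
    by rewrite distrC [`|x - y|]distrC; exact: h.
  rewrite distrC; have cxy : clamp s t x <= clamp s t y.
    by rewrite /clamp ge_max le_max lexx/= le_max le_min !ge_min lexx xy !orbT.
  have /andP[sx _] := clamp_itv s t x (ltW st).
  have /andP[_ yt] := clamp_itv s t y (ltW st).
  apply: le_trans (bounded_derivative_lipschitz _ _ _ _ _ cg dg Kg _ _ sx cxy yt) _.
  rewrite ler_wpM2l//; have := clamp_lip s t x y.
  by rewrite distrC; apply: le_trans; exact: ler_norm.
have gxc : continuous gx.
  move=> x; apply/cvgrPdist_le => e e0.
  have K1 : 0 < K + 1 by rewrite ltr_wpDl.
  near=> y; apply: le_trans (gxlip _ _) _.
  apply: (@le_trans _ _ ((K + 1) * `|x - y|)).
    by rewrite ler_wpM2r// lerDl.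
  rewrite -ler_pdivlMl// mulrC.
  by near: y; apply: cvgr_dist_le => //; rewrite divr_gt0.
have gxs u : s <= u <= t -> gx u = g u by move=> ?; rewrite /gx clamp_id.
(* starting the integral at [s - 1] makes [G] differentiable at [s] *)
pose G x := (\int[mu]_(u in `[s - 1, x]) gx u)%R.
have dG (x : R) : s - 1 < x -> is_derive x 1 G (gx x).
  move=> sx; have xx1 : x < x + 1 by rewrite ltrDl.
  have intgx : mu.-integrable `[s - 1, x + 1] (EFin \o gx).
    apply: continuous_compact_integrable; first exact: segment_compact.
    exact: continuous_subspaceT.
  have [dGx <-] := continuous_FTC1_closed xx1 intgx sx (gxc x).
  by rewrite derive1E; exact: DeriveDef.
pose phi (n : nat) u := n.+1%:R * (gx (u + n.+1%:R^-1) - gx u).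
pose Phi (n : nat) u := n.+1%:R * (G (u + n.+1%:R^-1) - G u).
have n1 (n : nat) : 0 < n.+1%:R^-1 :> R by rewrite invr_gt0.
have dPhi n (u : R) : s - 1 < u -> is_derive u 1 (Phi n) (phi n u).
  move=> su.
  have h1 := dG u su.
  have h2 : is_derive (u + n.+1%:R^-1) 1 G (gx (u + n.+1%:R^-1)).
    by apply: dG; rewrite ltr_wpDr// ltW.
  have h3 := is_derive1_comp (g := shift n.+1%:R^-1) h2 (is_derive_shift _ _ _).
  have := @is_deriveZ _ _ _ _ n.+1%:R _ _ _ (is_deriveB h3 h1).
  by rewrite mulr1.
have phic n : continuous (phi n).
  move=> u; apply: cvgM; first exact: cvg_cst.
  apply: cvgB; last exact: gxc.
  apply: (cvg_comp (fun v => v + n.+1%:R^-1) gx) (gxc _).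
  by apply: cvgD; [exact: cvg_id|exact: cvg_cst].
have intphi n : (\int[mu]_(u in `[s, t]) (phi n u)%:E)%E = (Phi n t - Phi n s)%:E.
  rewrite (continuous_FTC2 st (F := Phi n)).
  - by rewrite EFinB.
  - exact: continuous_subspaceT.
  - have cPhi u : s - 1 < u -> {for u, continuous (Phi n)}.
      move=> su; apply/differentiable_continuous/derivable1_diffP.
      by have [] := dPhi n u su.
    split.
    + by move=> u /[!in_itv]/= /andP[su _]; have [|] := dPhi n u; first lra.
    + by apply: cvg_at_right_filter; apply: cPhi; lra.
    + by apply: cvg_at_left_filter; apply: cPhi; lra.
  - move=> u /[!in_itv]/= /andP[su _]; rewrite derive1E.
    by have [|_ ->] := dPhi n u; first lra.
have Dcvg (u : R) : `]s, t[%classic u -> phi n u @[n --> \oo] --> Dg u.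
  move=> sut; apply: is_derive_harmonic_quotient.
  apply: near_eq_is_derive (dg _ sut).
  have /near_in_itvoo : u \in `]s, t[ by [].
  apply: filterS => v /[!in_itv]/= /andP[sv vt].
  by rewrite gxs// !ltW.
have mphi n : measurable_fun `]s, t[ (phi n).
  by apply: measurable_funTS; exact: continuous_measurable_fun (phic n).
have mDg : measurable_fun `]s, t[ Dg.
  by apply: (@measurable_fun_cvg _ _ _ _ phi) => // m; exact: mphi.
rewrite integral_itv_bndoo; last exact/measurable_EFinP.
have DcvgE : {ae mu, forall u, `]s, t[%classic u ->
    (EFin \o phi n) u @[n --> \oo] --> (EFin \o Dg) u}.
  by apply: aeW => u sut; apply: cvg_EFin; [exact: nearW|exact: Dcvg].
have phiK : {ae mu, forall u n, `]s, t[%classic u ->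
    (`|(EFin \o phi n) u| <= (EFin \o cst K) u)%E}.
  apply: aeW => u n sut; rewrite lee_fin /phi normrM.
  rewrite ger0_norm// mulrC -ler_pdivlMr// (le_trans (gxlip _ _))//.
  by rewrite addrAC subrr add0r ger0_norm// ltW.
have intK : mu.-integrable `]s, t[ (EFin \o cst K).
  apply: measurable_bounded_integrable => //.
    by rewrite /= lebesgue_measure_itv/= lte_fin st ltry.
  by exists K; split => [|x Kx y _]; rewrite ?num_real//= (le_trans _ (ltW Kx))// ger0_norm.
have [_ _] := @dominated_convergence _ _ R mu _ (measurable_itv _) _ _ _
  (fun n => (measurable_EFinP _ _).2 (mphi n))
  ((measurable_EFinP _ _).2 mDg) DcvgE intK phiK.
move/cvg_lim => <- //; apply/cvg_lim => //.
rewrite (_ : (fun _ => _) = fun n => (Phi n t - Phi n s)%:E); last first.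
  apply/funext => n; rewrite -intphi integral_itv_bndoo//.
  exact/measurable_EFinP.
apply: cvg_EFin; first exact: nearW.
rewrite -(gxs t) ?lexx ?ltW// -(gxs s) ?lexx ?ltW//.
by apply: cvgB; apply: is_derive_harmonic_quotient; apply: dG; lra.
Unshelve. all: by end_near. Qed.
End bounded_derivative.

(** The hypothesis says that [expR (c * u) * f u] has a nonnegative derivative. *)
Lemma exp_growth {R : realType} (f f' : R -> R) (c s t : R) : s <= t ->
  {within `[s, t], continuous f} ->
  (forall u, u \in `]s, t[ -> is_derive u 1 f (f' u)) ->
  (forall u, u \in `]s, t[ -> 0 <= c * f u + f' u) ->
  expR (c * s) * f s <= expR (c * t) * f t.
Proof.
move=> st cf df cf0.
have dg u : u \in `]s, t[ ->
    is_derive u 1 (fun v => expR (c * v) * f v) (expR (c * u) * (c * f u + f' u)).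
  move=> /df dfu; apply: is_derive_eq.
  rewrite /GRing.scale/= mulr1; ring.
apply: (@ger0_derive1_le_cc _ (fun v => expR (c * v) * f v) s t) => //.
- by move=> u /dg[].
- by move=> u ust; rewrite derive1E; have [_ ->] := dg u ust; rewrite mulr_ge0 ?expR_ge0 ?cf0.
- move=> u; apply: cvgM; last exact: cf.
  have ce : continuous (fun v => expR (c * v)).
    move=> v; apply: continuous_comp; last exact: continuous_expR.
    exact: mulrl_continuous.
  exact: (continuous_subspaceT ce).
- by rewrite in_itv/= lexx.
- by rewrite in_itv/= lexx andbT.
Qed.

(** The bound on [f'] makes [expR (K * u) * f u] nondecreasing, so that [f] stays
    positive and [ln f] has a derivative bounded by [K]. The factor [c] gives the
    integral of the opposite or of a multiple of [f' / f] without any appeal to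
    linearity, hence to integrability. *)
Lemma log_derivative_integral {R : realType} (f f' : R -> R) (K c s t : R) : s <= t ->
  {within `[s, t], continuous f} ->
  (forall u, u \in `]s, t[ -> is_derive u 1 f (f' u)) ->
  (forall u, u \in `]s, t[ -> `|f' u| <= K * f u) -> 0 < f s ->
  0 < f t /\
  (\int[lebesgue_measure]_(u in `[s, t]) (c * (f' u / f u))%:E =
    (c * (ln (f t) - ln (f s)))%:E)%E.
Proof.
move=> st cf df f'K fs0.
have pos u : s <= u <= t -> 0 < f u.
  move=> /andP[su ut].
  have h : expR (K * s) * f s <= expR (K * u) * f u.
    apply: (@exp_growth _ f f') => //.
    - by apply: continuous_subspaceW cf; apply: subset_itv; rewrite bnd_simp.
    - by move=> v /[!in_itv]/= /andP[sv vu]; apply: df; rewrite in_itv/= sv (lt_le_trans vu).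
    - move=> v /[!in_itv]/= /andP[sv vu].
      have /f'K : v \in `]s, t[ by rewrite in_itv/= sv (lt_le_trans vu).
      by rewrite ler_norml => /andP[]; lra.
  by rewrite -(pmulr_rgt0 _ (expR_gt0 (K * u))) (lt_le_trans _ h)// mulr_gt0 ?expR_gt0.
split; first by apply: pos; rewrite st lexx.
move: st; rewrite le_eqVlt => /predU1P[->|st].
  by rewrite set_itv1 integral_set1 subrr mulr0.
rewrite mulrBr; apply: (@bounded_derivative_FTC _ (fun u => c * ln (f u)) _ s t (`|c| * K)) => //.
- apply/subspace_continuousP => u /=; rewrite in_itv/= => ust.
  apply: cvgM; first exact: cvg_cst.
  apply: continuous_cvg; first exact/continuous_ln/pos.
  by move/subspace_continuousP : cf => /(_ u); apply; rewrite /= in_itv.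
- move=> u ust; have dfu := df u ust.
  have fu0 : 0 < f u by move: ust; rewrite in_itv/= => /andP[? ?]; apply: pos; rewrite !ltW.
  have := @is_deriveZ _ _ _ _ c _ _ _ (is_derive1_comp (is_derive1_ln fu0) dfu).
  by rewrite [_^-1 * _]mulrC.
- move=> u ust; have fu0 : 0 < f u by move: (ust); rewrite in_itv/= => /andP[? ?]; apply: pos; rewrite !ltW.
  by rewrite !normrM normfV (gtr0_norm fu0) ler_wpM2l// ler_pdivrMr// f'K.
Qed.

(** * Borel measurability of vector-valued maps *)

(** In a separable space an open set is a countable union of balls with centers in
    the dense family and radii [1 / (n + 1)]. *)
Lemma preimage_open_measurable {R : realType} {dT} {T : measurableType dT}
    {E : pseudoMetricType R} {I : countType} (D : I -> E) (f : T -> E) :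
  (forall x e, 0 < e -> exists i, ball (D i) e x) ->
  (forall i (n : nat), measurable (f @^-1` ball (D i) n.+1%:R^-1)) ->
  forall U : set E, open U -> measurable (f @^-1` U).
Proof.
move=> denseD mD U oU.
pose B (k : nat) : set E :=
  if unpickle k is Some (i, n) then
    if `[< ball (D i) (n.+1%:R^-1 : R) `<=` U >] then ball (D i) n.+1%:R^-1 else set0
  else set0.
have -> : U = \bigcup_k B k.
  apply/seteqP; split=> [x Ux|x [k _]]; last first.
    rewrite /B; case: (unpickle k) => // -[i n].
    by case: ifPn => // /asboolP; apply.
  have : nbhs x U by exact: open_nbhs_nbhs.
  move=> /nbhs_ballP[e /= e0 xeU].
  (* half of the radius: the center [D i] is only close to [x] *)
  have [n ne] : exists n : nat, n.+1%:R^-1 < e / 2.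
    have e20 : 0 < e / 2 by rewrite divr_gt0.
    have [n _ /(_ n (leqnn _))] := near_infty_natSinv_lt (PosNum e20).
    by exists n.
  have [i xi] := denseD x n.+1%:R^-1 ltac:(by rewrite invr_gt0).
  exists (pickle (i, n)) => //; rewrite /B pickleK asboolT// => y yi.
  apply: xeU; apply: (@le_ball _ _ _ (n.+1%:R^-1 + n.+1%:R^-1)).
    by rewrite (splitr e) lerD// ltW.
  exact: ball_triangle (ball_sym xi) yi.
rewrite preimage_bigcup; apply: bigcupT_measurable => k.
rewrite /B; case: (unpickle k) => [[i n]|]; last by rewrite preimage_set0.
by case: ifPn => // _; rewrite preimage_set0.
Qed.

Definition ratv {R : realType} {d} (q : 'rV[rat]_d) : 'rV[R]_d := map_mx ratr q.

Lemma ratv_dense {R : realType} {d} (x : 'rV[R]_d) (e : R) : 0 < e ->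
  exists q : 'rV[rat]_d, ball (ratv q : 'rV[R]_d) e x.
Proof.
move=> e0.
have /choice[q qP] : forall i : 'I_d, exists r : rat, ball (ratr r : R) e (x 0 i).
  move=> i; have /rat_in_itvoo[r] : x 0 i - e < x 0 i + e by lra.
  rewrite in_itv/= => /andP[h1 h2]; exists r.
  by rewrite /ball/= ltr_norml; apply/andP; split; lra.
exists (\row_i q i); split => // i j.
by rewrite !mxE (ord1 i).
Qed.

Section rV_measurable.
Context {R : realType} {d : nat} {dT : measure_display} {T : measurableType dT}.
Local Notation Rd := 'rV[R]_d.
Local Notation mfun f := (measurable_wrt (measurable : set (set T)) (f : T -> Rd)).

Lemma measurable_wrt_open (f : T -> Rd) :
  (forall U : set Rd, open U -> measurable (f @^-1` U)) -> mfun f.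
Proof.
move=> fU B mB; rewrite -[X in measurable X]setTI.
apply: (@measurability _ _ T (borel_rV R d) setT f (@open 'rV[R]_d)) => //.
by move=> _ [U oU <-]; rewrite setTI; exact: fU.
Qed.

Lemma open_measurable_wrt (f : T -> Rd) (U : set Rd) :
  mfun f -> open U -> measurable (f @^-1` U).
Proof. by move=> mf oU; apply: mf; exact: sub_sigma_algebra. Qed.

Lemma measurable_real_open (h : T -> R) :
  (forall U : set R, open U -> measurable (h @^-1` U)) -> measurable_fun setT h.
Proof.
move=> hU; apply: (measurability _ (RGenOpens.measurableE R)).
move=> _ [_ [a [b ->] <-]]; rewrite setTI; apply: hU.
exact: interval_open.
Qed.

Lemma measurable_wrt_comp (f : T -> Rd) (h : Rd -> R) :
  mfun f -> continuous h -> measurable_fun setT (h \o f).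
Proof.
move=> mf /continuousP ch; apply: measurable_real_open => U oU.
rewrite comp_preimage; exact/open_measurable_wrt/ch.
Qed.

Lemma measurable_wrt_coord (f : T -> Rd) i :
  mfun f -> measurable_fun setT (fun x => f x 0 i).
Proof. by move=> mf; apply: (measurable_wrt_comp f (fun v => v 0 i)) => //; exact: coord_continuous. Qed.

(** A ball of the maximum norm is a box, so its preimage is a finite intersection of
    preimages by the coordinates. *)
Lemma coord_measurable_wrt (f : T -> Rd) :
  (forall i, measurable_fun setT (fun x => f x 0 i)) -> mfun f.
Proof.
move=> mf; apply: measurable_wrt_open.
apply: (preimage_open_measurable ratv) => [x e|q n]; first exact: ratv_dense.
rewrite (_ : _ @^-1` _ = \bigcap_(i in [set: 'I_d])
    (fun x => f x 0 i) @^-1` ball (ratv q 0 i : R) n.+1%:R^-1); last first.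
  apply/seteqP; split=> [x [_ /= h] i _|x /= h]; first exact: h.
  by split=> [|i j]; rewrite ?invr_gt0// (ord1 i); exact: h.
apply: fin_bigcap_measurable => // i _; rewrite -[X in measurable X]setTI.
apply: mf => //; apply: open_measurable; exact: ball_open.
Qed.

Lemma measurable_wrt_comp2 (f1 f2 : T -> Rd) (h : Rd * Rd -> R) :
  mfun f1 -> mfun f2 -> continuous h -> measurable_fun setT (fun x => h (f1 x, f2 x)).
Proof.
move=> mf1 mf2 /continuousP ch; apply: measurable_real_open => U oU.
rewrite (_ : _ @^-1` _ = (fun x => (f1 x, f2 x)) @^-1` (h @^-1` U))//.
apply: (preimage_open_measurable (fun q : 'rV[rat]_d * 'rV[rat]_d => (ratv q.1, ratv q.2)));
  last exact: ch.
- move=> [x y] e e0.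
  have [q qx] := ratv_dense x _ e0; have [r ry] := ratv_dense y _ e0.
  by exists (q, r).
- move=> [q r] n; rewrite (_ : _ @^-1` _ =
    (f1 @^-1` ball (ratv q) n.+1%:R^-1) `&` (f2 @^-1` ball (ratv r) n.+1%:R^-1))//.
  by apply: measurableI; apply: open_measurable_wrt => //; exact: ball_open.
Qed.

End rV_measurable.

(** * Square integrable random vectors *)

Section dot.
Context {R : realType} {n : nat}.
Implicit Types (u v w : 'rV[R]_n) (a : R).

Lemma dotvE u v : dotv u v = \sum_i u 0 i * v 0 i.
Proof. by rewrite /dotv mxE; apply: eq_bigr => i _; rewrite mxE. Qed.

Lemma dotvC u v : dotv u v = dotv v u.
Proof. by rewrite !dotvE; apply: eq_bigr => i _; rewrite mulrC. Qed.

Lemma dotvDl u v w : dotv (u + v) w = dotv u w + dotv v w.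
Proof. by rewrite /dotv mulmxDl mxE. Qed.

Lemma dotvZl a u v : dotv (a *: u) v = a * dotv u v.
Proof. by rewrite /dotv -scalemxAl mxE. Qed.

Lemma dotvDr u v w : dotv u (v + w) = dotv u v + dotv u w.
Proof. by rewrite dotvC dotvDl !(dotvC u). Qed.

Lemma dotvZr a u v : dotv u (a *: v) = a * dotv u v.
Proof. by rewrite dotvC dotvZl (dotvC u). Qed.

Lemma dotvv_ge0 u : 0 <= dotv u u.
Proof. by rewrite dotvE sumr_ge0// => i _; rewrite -expr2 sqr_ge0. Qed.

Lemma enorm_sqr u : enorm u ^+ 2 = dotv u u.
Proof. by rewrite sqr_sqrtr ?dotvv_ge0. Qed.

Lemma enorm_ge0 u : 0 <= enorm u. Proof. exact: sqrtr_ge0. Qed.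

Lemma coord_le_enorm u i : `|u 0 i| <= enorm u.
Proof.
rewrite -(@ler_pXn2r _ 2) ?nnegrE ?enorm_ge0// enorm_sqr dotvE real_normK ?num_real//.
by rewrite (bigD1 i)//= expr2 lerDl sumr_ge0// => j _; rewrite -expr2 sqr_ge0.
Qed.

Lemma dotv_le u v : `|dotv u v| <= dotv u u + dotv v v.
Proof.
have h a b : 0 <= dotv u u + dotv v v + (a ^+ 2 - 1) * dotv u u + (b ^+ 2 - 1) * dotv v v
    + 2 * a * b * dotv u v.
  have := dotvv_ge0 (a *: u + b *: v).
  by rewrite !(dotvDl, dotvDr, dotvZl, dotvZr) (dotvC v u); nra.
have := h 1 1; have := h 1 (-1); have := dotvv_ge0 u; have := dotvv_ge0 v.
by rewrite ler_norml; lra.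
Qed.

Lemma dotvDD_le u v : dotv (u + v) (u + v) <= 2 * dotv u u + 2 * dotv v v.
Proof.
have := dotvv_ge0 (u + (-1) *: v).
by rewrite !(dotvDl, dotvDr, dotvZl, dotvZr) (dotvC v u); lra.
Qed.
End dot.

Section square_integrable.
Context {R : realType} {d : nat} {dO : measure_display} {Omega : measurableType dO}.
Variable P : probability Omega R.
Local Notation Rd := 'rV[R]_d.
Implicit Types (Z V U : Omega -> Rd).

(** The case [G := F t] is [inH P F t]; the case of the whole sigma-algebra is
    used to compare vectors taken at different times. *)
Definition sqint (G : set (set Omega)) Z :=
  measurable_wrt G Z /\ (\int[P]_w (enorm (Z w) ^+ 2)%:E < +oo)%E.

Local Notation L2 := (sqint (measurable : set (set Omega))).
Local Notation integrableR f := (P.-integrable setT (EFin \o f)).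

Lemma dominated_integrableR (f g : Omega -> R) : measurable_fun setT f ->
  integrableR g -> (forall w, `|f w| <= g w) -> integrableR f.
Proof.
move=> mf ig fg; apply: le_integrable ig => //; first exact/measurable_EFinP.
by move=> w _; rewrite /= lee_fin (le_trans (fg w))// ler_norm.
Qed.

Lemma integrableR_D (f g : Omega -> R) : integrableR f -> integrableR g ->
  integrableR (fun w => f w + g w).
Proof. by move=> fi gi; have := integrableD measurableT fi gi; apply: eq_integrable. Qed.

Lemma integrableR_Z (a : R) (f : Omega -> R) : integrableR f ->
  integrableR (fun w => a * f w).
Proof. by move=> fi; have := integrableZl measurableT a fi; apply: eq_integrable. Qed.

Lemma measurable_dotv Z V : measurable_wrt measurable Z -> measurable_wrt measurable V ->
  measurable_fun setT (fun w => dotv (Z w) (V w)).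
Proof.
move=> mZ mV; under eq_fun do rewrite dotvE.
by apply: measurable_sum => i; apply: measurable_funM; exact: measurable_wrt_coord.
Qed.

Lemma sqintP Z : L2 Z <->
  measurable_wrt measurable Z /\ integrableR (fun w => dotv (Z w) (Z w)).
Proof.
have e w : (`|(EFin \o (fun w => dotv (Z w) (Z w))) w| = (enorm (Z w) ^+ 2)%:E)%E.
  by rewrite /= ger0_norm ?dotvv_ge0// enorm_sqr.
split=> -[mZ iZ]; split => //.
  apply/integrableP; split; first exact/measurable_EFinP/measurable_dotv.
  by under eq_integral do rewrite e.
by move/integrableP: iZ => [_]; under eq_integral do rewrite e.
Qed.

Lemma sqint_dotv Z V : L2 Z -> L2 V -> integrableR (fun w => dotv (Z w) (V w)).
Proof.
move=> /sqintP[mZ iZ] /sqintP[mV iV].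
apply: (dominated_integrableR _ _ _ (integrableR_D _ _ iZ iV)); first exact: measurable_dotv.
by move=> w; exact: dotv_le.
Qed.

Lemma sqintD Z V : L2 Z -> L2 V -> L2 (fun w => Z w + V w).
Proof.
move=> /sqintP[mZ iZ] /sqintP[mV iV]; apply/sqintP.
have mZV : measurable_wrt measurable (fun w => Z w + V w).
  apply: coord_measurable_wrt => i; under eq_fun do rewrite mxE.
  by apply: measurable_funD; exact: measurable_wrt_coord.
split => //; apply: (dominated_integrableR _ _ _
  (integrableR_D _ _ (integrableR_Z 2 _ iZ) (integrableR_Z 2 _ iV))); first exact: measurable_dotv.
by move=> w; rewrite ger0_norm ?dotvv_ge0// dotvDD_le.
Qed.

Lemma sqintZ a Z : L2 Z -> L2 (fun w => a *: Z w).
Proof.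
move=> /sqintP[mZ iZ]; apply/sqintP; split.
  apply: coord_measurable_wrt => i; under eq_fun do rewrite mxE.
  by apply: measurable_funM => //; exact: measurable_wrt_coord.
by under eq_fun do rewrite dotvZl dotvZr; do 2 apply: integrableR_Z.
Qed.

Lemma hdotC Z V : hdot P Z V = hdot P V Z.
Proof. by rewrite /hdot; under eq_Rintegral do rewrite dotvC. Qed.

Lemma hdotDr Z V U : L2 Z -> L2 V -> L2 U ->
  hdot P Z (fun w => V w + U w) = hdot P Z V + hdot P Z U.
Proof.
move=> iZ iV iU; rewrite /hdot -RintegralD//; try exact: sqint_dotv.
by apply: eq_Rintegral => w _; rewrite dotvDr.
Qed.

Lemma hdotZr a Z V : L2 Z -> L2 V -> hdot P Z (fun w => a *: V w) = a * hdot P Z V.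
Proof.
move=> iZ iV; rewrite /hdot -RintegralZl//; last exact: sqint_dotv.
by apply: eq_Rintegral => w _; rewrite dotvZr.
Qed.

Lemma hdotDl Z V U : L2 Z -> L2 V -> L2 U ->
  hdot P (fun w => V w + U w) Z = hdot P V Z + hdot P U Z.
Proof. by move=> *; rewrite hdotC hdotDr// !(hdotC Z). Qed.

Lemma hdotZl a Z V : L2 Z -> L2 V -> hdot P (fun w => a *: V w) Z = a * hdot P V Z.
Proof. by move=> *; rewrite hdotC hdotZr// (hdotC Z). Qed.

Lemma hdot_ge0 Z : 0 <= hdot P Z Z.
Proof. by apply: Rintegral_ge0 => w _; exact: dotvv_ge0. Qed.

Lemma hnorm_ge0 Z : 0 <= hnorm P Z. Proof. exact: sqrtr_ge0. Qed.

Lemma hnorm_sqr Z : hnorm P Z ^+ 2 = hdot P Z Z.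
Proof. by rewrite sqr_sqrtr ?hdot_ge0. Qed.

(** The nonnegative form [|a Z + b V|^2] is evaluated at [a = - <Z, V>] and
    [b = |Z|^2]. When [|Z| = 0], the choice [a = - (|V|^2 + 1) / <Z, V>] and [b = 1]
    would make it negative if [<Z, V>] were not zero. *)
Lemma hdot_CauchySchwarz Z V : L2 Z -> L2 V -> `|hdot P Z V| <= hnorm P Z * hnorm P V.
Proof.
move=> iZ iV.
have key a b : 0 <= a ^+ 2 * hdot P Z Z + 2 * (a * b) * hdot P Z V + b ^+ 2 * hdot P V V.
  have := hdot_ge0 (fun w => a *: Z w + b *: V w).
  have iaZ := sqintZ a _ iZ; have ibV := sqintZ b _ iV.
  rewrite (hdotDl _ _ _ (sqintD _ _ iaZ ibV) iaZ ibV).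
  rewrite (hdotDr _ _ _ iaZ iaZ ibV) (hdotDr _ _ _ ibV iaZ ibV).
  rewrite (hdotZl a _ _ iaZ iZ) (hdotZl a _ _ ibV iZ) (hdotZl b _ _ iaZ iV) (hdotZl b _ _ ibV iV).
  rewrite (hdotZr a _ _ iZ iZ) (hdotZr b _ _ iZ iV) (hdotZr a _ _ iV iZ) (hdotZr b _ _ iV iV).
  by rewrite (hdotC V Z); nra.
rewrite -!hnorm_sqr in key.
have Z0 := hnorm_ge0 Z; have V0 := hnorm_ge0 V.
move: key Z0 V0; set z := hnorm P Z; set v := hnorm P V; set h := hdot P Z V => key Z0 V0.
have [z0|z0] := eqVneq z 0.
  rewrite z0 mul0r normr_le0; apply/eqP; apply: contrapT => /eqP h0.
  have := key (- (v ^+ 2 + 1) / h) 1.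
  have -> : 2 * (- (v ^+ 2 + 1) / h * 1) * h = - 2 * (v ^+ 2 + 1) by field.
  by rewrite z0 => k; have := sqr_ge0 v; nra.
have zp : 0 < z ^+ 2 by rewrite exprn_even_gt0.
rewrite -(@ler_pXn2r _ 2) ?nnegrE ?mulr_ge0// real_normK ?num_real//.
rewrite -(ler_pM2l zp) exprMn; have := key (- h) (z ^+ 2); nra.
Qed.

End square_integrable.

(** * Two independent copies of a probability space *)

Section product_space.
Context {R : realType} {dO : measure_display} {Omega : measurableType dO}.
Variable P : probability Omega R.
Local Notation PP := (P \x P)%E.
Local Notation integrable1 f := (P.-integrable setT (EFin \o f)).
Local Notation integrable2 f := (PP.-integrable setT (EFin \o f)).

Lemma integral_cst_prob (c : \bar R) : (\int[P]_w c = c)%E.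
Proof. by rewrite integral_cst//= probability_setT mule1. Qed.

Lemma integrable_fst (g : Omega -> R) : integrable1 g -> integrable2 (fun w => g w.1).
Proof.
move=> /integrableP[mg ig]; apply/integrable12ltyP.
  by apply: (measurableT_comp mg); exact: measurable_fst.
by under eq_integral do rewrite /= integral_cst_prob.
Qed.

Lemma integrable_snd (g : Omega -> R) : integrable1 g -> integrable2 (fun w => g w.2).
Proof.
move=> /integrableP[mg ig]; apply/integrable12ltyP.
  by apply: (measurableT_comp mg); exact: measurable_snd.
by rewrite /= integral_cst_prob.
Qed.

(** Integrability of every section makes the inner integral finite everywhere, so that
    it can be taken in [R]. *)
Lemma Rintegral_fubini (f : Omega * Omega -> R) : integrable2 f ->
  (forall w, integrable1 (fun w' => f (w, w'))) ->
  integrable1 (fun w => \int[P]_w' f (w, w')) /\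
  \int[PP]_z f z = \int[P]_w \int[P]_w' f (w, w').
Proof.
move=> fi fwi.
have e w : (\int[P]_w' (f (w, w'))%:E = (\int[P]_w' f (w, w'))%:E)%E.
  by rewrite fineK//; exact: integrable_fin_num (fwi w).
split.
  have := integrable_fubini_F fi; apply: eq_integrable => // w _.
  by rewrite /= /fubini_F -e.
rewrite /Rintegral -integral12_prod_meas1//; congr fine.
by apply: eq_integral => w _; rewrite /fubini_F e.
Qed.

Lemma Rintegral_fst (g : Omega -> R) : integrable1 g -> \int[PP]_z g z.1 = \int[P]_w g w.
Proof.
move=> ig; have [|_ ->] := Rintegral_fubini _ (integrable_fst _ ig).
  by move=> w; exact: (finite_measure_integrable_cst P (g w) measurableT).
by apply: eq_Rintegral => w _; rewrite /= Rintegral_cst//= probability_setT mulr1.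
Qed.

Lemma Rintegral_snd (g : Omega -> R) : integrable1 g -> \int[PP]_z g z.2 = \int[P]_w g w.
Proof.
move=> ig; have [|_ ->] := Rintegral_fubini _ (integrable_snd _ ig) => //=.
by rewrite Rintegral_cst//= probability_setT mulr1.
Qed.

Lemma integrable_swap (f : Omega * Omega -> R) : integrable2 f ->
  integrable2 (fun z => f (z.2, z.1)).
Proof.
move=> fi; have mf := measurable_int _ fi; apply/integrable12ltyP.
  apply: (measurableT_comp mf); apply/measurable_fun_pairP; split => /=.
    exact: measurable_snd.
  exact: measurable_fst.
by have /integrable21ltyP := fi; apply.
Qed.

Lemma Rintegral_swap (f : Omega * Omega -> R) : integrable2 f ->
  \int[PP]_z f z = \int[PP]_z f (z.2, z.1).
Proof.
move=> fi; have fi' := integrable_swap _ fi.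
by rewrite /Rintegral -integral12_prod_meas1// -[in RHS]integral21_prod_meas1.
Qed.

Lemma integral_rect (f : Omega * Omega -> R) (A : set Omega) : measurable A ->
  integrable2 f -> (forall w, integrable1 (fun w' => f (w, w'))) ->
  (\int[PP]_(z in A `*` setT) (f z)%:E = \int[P]_(w in A) (\int[P]_w' f (w, w'))%:E)%E.
Proof.
move=> mA fi fwi.
have mAT : measurable (A `*` [set: Omega]) by exact: measurableX.
rewrite integral_mkcond -integral12_prod_meas1; last first.
  apply/integrable_restrict => //; rewrite setTI.
  exact: integrableS fi.
rewrite [RHS]integral_mkcond; apply: eq_integral => w _; rewrite /fubini_F patchE.
case: ifPn => [/set_mem|/negP] wA.
  rewrite [RHS]fineK; last exact: integrable_fin_num (fwi w).
  by apply: eq_integral => w' _; rewrite patchE ifT// inE.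
apply: integral0_eq => w' _; rewrite patchE ifF//.
by apply/negP => /set_mem[/= /mem_set].
Qed.

Lemma integral_rect_fst (g : Omega -> R) (A : set Omega) : measurable A ->
  integrable1 g ->
  (\int[PP]_(z in A `*` setT) (g z.1)%:E = \int[P]_(w in A) (g w)%:E)%E.
Proof.
move=> mA ig; rewrite (integral_rect (fun z => g z.1) A mA (integrable_fst _ ig)).
  by apply: eq_integral => w _; rewrite /= Rintegral_cst//= probability_setT mulr1.
by move=> w; exact: (finite_measure_integrable_cst P (g w) measurableT).
Qed.

End product_space.

(** * The drift of a pair and its conditional expectation *)

Section pair_drift.
Context {R : realType} {d : nat}.
Local Notation Rd := 'rV[R]_d.
Variables G1 G2 : Rd -> Rd -> 'M[R]_d.

(** The integrand of the differential of the drift, for a position [x], a tangent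
    vector [z] and their copies [x'] and [z']. *)
Definition pair_drift (x z x' z' : Rd) : Rd := z *m G1 x x' + z' *m G2 x x'.

Definition bounded_kernel (C : R) (G : Rd -> Rd -> 'M[R]_d) :=
  [/\ 0 <= C, forall k i, continuous (fun p : Rd * Rd => G p.1 p.2 k i) &
      forall x x' k i, `|G x x' k i| <= C].

Lemma mulmx_bound (C : R) (z : Rd) (M : 'M[R]_d) i :
  (forall k i, `|M k i| <= C) -> `|(z *m M) 0 i| <= d%:R * C * enorm z.
Proof.
move=> MC; rewrite mxE (le_trans (ler_norm_sum _ _ _))//.
apply: (@le_trans _ _ (\sum_(k < d) C * enorm z)).
  by apply: ler_sum => k _; rewrite normrM mulrC ler_pM// coord_le_enorm.
by rewrite sumr_const card_ord -mulrA mulr_natl.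
Qed.

Variables (C : R) (bG1 : bounded_kernel C G1) (bG2 : bounded_kernel C G2).

Lemma pair_drift_bound x z x' z' i :
  `|pair_drift x z x' z' 0 i| <= d%:R * C * (enorm z + enorm z').
Proof.
rewrite mxE (le_trans (ler_normD _ _))// mulrDr lerD//; apply: mulmx_bound.
  by case: bG1.
by case: bG2.
Qed.

(** Each coordinate of the pair drift is at most [d * C * (|z| + |z'|)], and there are
    [d] of them; the factor 2 comes from the Young inequality. *)
Lemma dotv_pair_drift_bound x z x' z' :
  `|dotv (pair_drift x z x' z') z| <= 2 * d%:R ^+ 2 * C * (dotv z z + dotv z' z').
Proof.
have [C0 _ _] := bG1; rewrite dotvE (le_trans (ler_norm_sum _ _ _))//.
have N0 := enorm_ge0 z; have N'0 := enorm_ge0 z'.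
apply: (@le_trans _ _ (\sum_(k < d) d%:R * C * (enorm z + enorm z') * enorm z)).
  by apply: ler_sum => k _; rewrite normrM ler_pM// ?pair_drift_bound// coord_le_enorm.
rewrite sumr_const card_ord -[_ *+ d]mulr_natl -!enorm_sqr.
have D0 : 0 <= d%:R ^+ 2 * C by rewrite mulr_ge0// sqr_ge0.
have : (enorm z + enorm z') * enorm z <= 2 * (enorm z ^+ 2 + enorm z' ^+ 2) by nra.
move=> /(ler_wpM2l D0) h; rewrite [leLHS](_ : _ = d%:R ^+ 2 * C * ((enorm z + enorm z') * enorm z)); last by ring.
by rewrite [leRHS](_ : _ = d%:R ^+ 2 * C * (2 * (enorm z ^+ 2 + enorm z' ^+ 2))); last by ring.
Qed.

Section measurability.
Context {d1 d2 : measure_display} {T1 : measurableType d1} {T2 : measurableType d2}.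
Variables (X1 Z1 : T1 -> Rd) (X2 Z2 : T2 -> Rd).
Hypotheses (mX1 : measurable_wrt measurable X1) (mZ1 : measurable_wrt measurable Z1).
Hypotheses (mX2 : measurable_wrt measurable X2) (mZ2 : measurable_wrt measurable Z2).

Lemma measurable_wrt_fst (f : T1 -> Rd) : measurable_wrt measurable f ->
  measurable_wrt measurable (fun w : T1 * T2 => f w.1).
Proof.
move=> mf B /mf mB; have := @measurable_fst _ _ T1 T2 measurableT _ mB.
by rewrite setTI.
Qed.

Lemma measurable_wrt_snd (f : T2 -> Rd) : measurable_wrt measurable f ->
  measurable_wrt measurable (fun w : T1 * T2 => f w.2).
Proof.
move=> mf B /mf mB; have := @measurable_snd _ _ T1 T2 measurableT _ mB.
by rewrite setTI.
Qed.

Lemma measurable_pair_drift i :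
  measurable_fun setT (fun w : T1 * T2 => pair_drift (X1 w.1) (Z1 w.1) (X2 w.2) (Z2 w.2) 0 i).
Proof.
have mprod (G : Rd -> Rd -> 'M[R]_d) (Z : T1 * T2 -> Rd) :
    bounded_kernel C G -> measurable_wrt measurable Z ->
    measurable_fun setT (fun w : T1 * T2 => (Z w *m G (X1 w.1) (X2 w.2)) 0 i).
  move=> bG mZ; under eq_fun do rewrite mxE.
  apply: measurable_sum => k; apply: measurable_funM; first exact: measurable_wrt_coord.
  apply: (measurable_wrt_comp2 _ _ (fun p => G p.1 p.2 k i)); last by case: bG.
    exact: measurable_wrt_fst.
  exact: measurable_wrt_snd.
under eq_fun do rewrite mxE.
apply: measurable_funD; apply: mprod => //.
  exact: measurable_wrt_fst.
exact: measurable_wrt_snd.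
Qed.

(** The domain [T1] is left free because the result is needed on the space equipped
    with the smaller sigma-algebra [F t]. *)
Lemma measurable_fun_Rintegral_pair_drift (m2 : probability T2 R) i :
  measurable_fun setT
    (fun w => \int[m2]_w' pair_drift (X1 w) (Z1 w) (X2 w') (Z2 w') 0 i).
Proof.
pose f (z : T1 * T2) := (pair_drift (X1 z.1) (Z1 z.1) (X2 z.2) (Z2 z.2) 0 i)%:E.
have mf : measurable_fun setT f by apply/measurable_EFinP; exact: measurable_pair_drift.
apply: (measurableT_comp (f := fine)) => //.
rewrite (_ : (fun _ => _) = (fun w => \int[m2]_w' f^\+ (w, w') - \int[m2]_w' f^\- (w, w'))%E).
  apply: emeasurable_funB.
    by apply: (measurable_fun_fubini_tonelli_F (f^\+)%E) => //; exact: measurable_funepos.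
  by apply: (measurable_fun_fubini_tonelli_F (f^\-)%E) => //; exact: measurable_funeneg.
apply/funext => w; rewrite integralE; congr (_ - _)%E; apply: eq_integral => w' _.
  by rewrite !funeposE.
by rewrite !funenegE.
Qed.

End measurability.
End pair_drift.

Section conditional_drift.
Context {R : realType} {d : nat} {dO : measure_display} {Omega : measurableType dO}.
Variables (P : probability Omega R) (G : set (set Omega)).
Hypotheses (sG : sigma_algebra setT G) (Gm : G `<=` measurable).
Local Notation Rd := 'rV[R]_d.
Local Notation PP := (P \x P)%E.
Local Notation TG := (g_sigma_algebraType G).
Implicit Types (X Z V : Omega -> Rd).

(** [TG] is the same space carrying only the sigma-algebra [G], which turns
    [G]-measurability into measurability of functions on a measurable type. *)
Lemma measurable_TG : (measurable : set (set TG)) = G.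
Proof. exact: sigma_algebra_id. Qed.

Lemma measurable_wrt_TG V : measurable_wrt G V -> measurable_wrt (measurable : set (set TG)) V.
Proof. by rewrite measurable_TG. Qed.

Lemma measurable_wrt_sub V : measurable_wrt G V -> measurable_wrt measurable V.
Proof. by move=> mV B mB; exact/Gm/mV. Qed.

(** The set where [g < f] belongs to [G], and the integral of [f - g] over it vanishes. *)
Lemma ae_le_of_integral (f g : Omega -> R) :
  measurable_fun (setT : set TG) f -> measurable_fun (setT : set TG) g ->
  P.-integrable setT (EFin \o f) -> P.-integrable setT (EFin \o g) ->
  (forall A, G A -> (\int[P]_(w in A) (f w)%:E = \int[P]_(w in A) (g w)%:E)%E) ->
  {ae P, forall w, f w <= g w}.
Proof.
move=> mf mg fi gi fg.
pose A := [set w | g w < f w].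
have GA : G A.
  have mfg := measurable_funB mf mg.
  have := mfg measurableT `]0, +oo[%classic (measurable_itv _).
  rewrite setTI measurable_TG; congr G; apply/seteqP; split => w /=;
    by rewrite in_itv/= andbT subr_gt0.
have mA : measurable A by exact: Gm.
have intA : (\int[P]_(w in A) (f w - g w)%:E = 0)%E.
  under eq_integral do rewrite EFinB.
  rewrite integralB//; [|exact: integrableS fi|exact: integrableS gi].
  rewrite fg// subee//; apply: integrable_fin_num => //; exact: integrableS gi.
have mfg : measurable_fun A (fun w => (f w - g w)%:E).
  apply/measurable_EFinP; apply: measurable_funB.
    by have := measurable_int _ fi; move/measurable_EFinP; exact: measurable_funS.
  by have := measurable_int _ gi; move/measurable_EFinP; exact: measurable_funS.
have : (\int[P]_(w in A) `|(f w - g w)%:E| = 0)%E.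
  rewrite -intA; apply: eq_integral => w /set_mem wA.
  by rewrite gee0_abs// lee_fin subr_ge0 ltW.
move/(ae_eq_integral_abs _ mA mfg).
apply: filterS => w /= h; rewrite leNgt; apply/negP => gf.
by have [] := h gf; move: gf => /[swap] /eqP; rewrite subr_eq0 => /eqP ->; rewrite ltxx.
Qed.

Variables (G1 G2 : Rd -> Rd -> 'M[R]_d) (C : R).
Hypotheses (bG1 : bounded_kernel C G1) (bG2 : bounded_kernel C G2).
Variables (X Z : Omega -> Rd).
Hypotheses (mX : measurable_wrt G X) (iZ : sqint P G Z).

Local Notation K w w' := (pair_drift G1 G2 (X w) (Z w) (X w') (Z w')).

(** Integrating over the second copy gives a version of the conditional expectation,
    the copies being independent. *)
Definition mean_pair_drift : Omega -> Rd := fun w => \row_i \int[P]_w' K w w' 0 i.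

Let mX' := measurable_wrt_sub X mX.
Let mZ' := measurable_wrt_sub Z iZ.1.
Let iZ' : sqint P measurable Z := conj mZ' iZ.2.

(* an integrable function above the norm of [Z] *)
Let N w := 1 + dotv (Z w) (Z w).

Let enormN w : enorm (Z w) <= N w.
Proof. by rewrite /N -enorm_sqr; have := sqr_ge0 (enorm (Z w) - 1); nra. Qed.

Let iN : P.-integrable setT (EFin \o N).
Proof.
apply: integrableR_D; first exact: (finite_measure_integrable_cst P 1 measurableT).
by have [_] := (sqintP P Z).1 iZ'.
Qed.

Let KN w w' i : `|K w w' 0 i| <= d%:R * C * (N w + N w').
Proof.
apply: le_trans (pair_drift_bound _ _ _ bG1 bG2 _ _ _ _ _) _.
by rewrite ler_wpM2l ?lerD// mulr_ge0//; case: bG1.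
Qed.

Let iNN : PP.-integrable setT (EFin \o (fun w => d%:R * C * (N w.1 + N w.2))).
Proof.
apply: integrableR_Z; apply: integrableR_D; first exact: integrable_fst.
exact: integrable_snd.
Qed.

Let integrable_K i : PP.-integrable setT (EFin \o (fun w => K w.1 w.2 0 i)).
Proof.
apply: (dominated_integrableR _ _ _ _ iNN) => [|w]; last exact: KN.
exact: (measurable_pair_drift _ _ _ bG1 bG2).
Qed.

Let integrable_K2 i w : P.-integrable setT (EFin \o (fun w' => K w w' 0 i)).
Proof.
apply: (@dominated_integrableR _ _ _ P _ (fun w' => d%:R * C * (N w + N w'))).
- have mK := measurable_pair_drift _ _ _ bG1 bG2 _ _ _ _ mX' mZ' mX' mZ' i.
  exact: (measurableT_comp mK (pair1_measurable w)).
- apply: integrableR_Z; apply: integrableR_D => //.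
  exact: (finite_measure_integrable_cst P (N w) measurableT).
- by move=> w'; exact: KN.
Qed.

Let mV : measurable_wrt G mean_pair_drift.
Proof.
rewrite -measurable_TG; apply: coord_measurable_wrt => i.
under eq_fun do rewrite mxE.
apply: (measurable_fun_Rintegral_pair_drift _ _ _ bG1 bG2) => //.
  exact: measurable_wrt_TG.
exact: (measurable_wrt_TG Z iZ.1).
Qed.

Let iV i : P.-integrable setT (EFin \o (fun w => mean_pair_drift w 0 i)).
Proof.
have [+ _] := Rintegral_fubini P _ (integrable_K i) (integrable_K2 i).
by apply: eq_integrable => // w _; rewrite /= mxE.
Qed.

Lemma mean_pair_drift_condexp :
  is_condexp PP [set A `*` setT | A in G] (fun w => K w.1 w.2) (fun w => mean_pair_drift w.1).
Proof.
split => //.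
- move=> B mB; exists (mean_pair_drift @^-1` B); first exact: mV.
  by apply/seteqP; split => [w []|w].
- by move=> i; exact: (integrable_fst P _ (iV i)).
- move=> _ [A GA <-] i; have mA := Gm _ GA.
  rewrite [LHS](integral_rect_fst P (fun w => mean_pair_drift w 0 i) A mA (iV i)).
  rewrite [RHS](integral_rect P (fun z => K z.1 z.2 0 i) A mA (integrable_K i) (integrable_K2 i)).
  by apply: eq_integral => w _; rewrite mxE.
Qed.

(** A set of the form [A `*` setT] determines [A], so [V] is [G]-measurable; its
    integrals over the sets of [G] are those of [mean_pair_drift]. *)
Lemma condexp_unique V :
  is_condexp PP [set A `*` setT | A in G] (fun w => K w.1 w.2) (fun w => V w.1) ->
  measurable_wrt G V /\ {ae P, forall w, V w = mean_pair_drift w}.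
Proof.
move=> [mV1 _ iV1 eV1]; have [_ _ _ eM] := mean_pair_drift_condexp.
have mV2 : measurable_wrt G V.
  move=> B mB; have [A GA AB] := mV1 B mB.
  rewrite (_ : V @^-1` B = A)//; apply/seteqP; split => w Vw.
    have : ((fun w : Omega * Omega => V w.1) @^-1` B) (w, point) by [].
    by rewrite -AB => -[].
  have : (A `*` setT) (w, point : Omega) by [].
  by rewrite AB.
have iV2 i : P.-integrable setT (EFin \o (fun w => V w 0 i)).
  have mVi : measurable_fun setT (fun w => V w 0 i).
    exact/measurable_wrt_coord/measurable_wrt_sub.
  have /integrable21ltyP := iV1 i.
  rewrite /= integral_cst_prob => h; apply/integrableP; split.
    exact/measurable_EFinP.
  apply: h; apply/measurable_EFinP.
  apply: (measurableT_comp mVi); exact: measurable_fst.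
have eq_int i A : G A -> (\int[P]_(w in A) (V w 0 i)%:E =
    \int[P]_(w in A) (mean_pair_drift w 0 i)%:E)%E.
  move=> GA; have mA := Gm _ GA.
  have AT : [set A `*` setT | A in G] (A `*` (setT : set Omega)) by exists A.
  rewrite -[LHS](integral_rect_fst P (fun w => V w 0 i) A mA (iV2 i)).
  rewrite -[RHS](integral_rect_fst P (fun w => mean_pair_drift w 0 i) A mA (iV i)).
  exact: (etrans (eV1 _ AT i) (esym (eM _ AT i))).
split => //.
have mTG (U : Omega -> Rd) i : measurable_wrt G U ->
    measurable_fun (setT : set TG) (fun w => U w 0 i).
  by move=> /measurable_wrt_TG mU; exact: measurable_wrt_coord.
have h1 i : {ae P, forall w, V w 0 i <= mean_pair_drift w 0 i}.
  by apply: ae_le_of_integral => //; [exact: mTG|exact: mTG|exact: eq_int].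
have h2 i : {ae P, forall w, mean_pair_drift w 0 i <= V w 0 i}.
  by apply: ae_le_of_integral => //; [exact: mTG|exact: mTG|move=> A /eq_int].
have h : {ae P, forall w, forall i, V w 0 i = mean_pair_drift w 0 i}.
  apply: filter_forall => i.
  move: (h1 i) (h2 i); apply: filterS2 => w le1 le2.
  by apply/eqP; rewrite eq_le le1.
by apply: filterS h => w Vw; apply/rowP.
Qed.

(** By uniqueness it suffices to treat [mean_pair_drift]. It is bounded by a multiple
    of [|Z| + E (1 + |Z|^2)], hence square integrable, and its scalar product with
    [Z] is computed by the Fubini theorem. *)
Lemma condexp_hdot V :
  is_condexp PP [set A `*` setT | A in G] (fun w => K w.1 w.2) (fun w => V w.1) ->
  [/\ sqint P G V,
      PP.-integrable setT (EFin \o (fun w => dotv (K w.1 w.2) (Z w.1))) &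
      hdot P Z V = \int[PP]_w dotv (K w.1 w.2) (Z w.1)].
Proof.
move=> /condexp_unique[mV2 aeV].
have iZZ : P.-integrable setT (EFin \o (fun w => dotv (Z w) (Z w))).
  by have [_] := (sqintP P Z).1 iZ'.
have mK i := measurable_pair_drift _ _ _ bG1 bG2 _ _ _ _ mX' mZ' mX' mZ' i.
have mq : measurable_fun setT (fun w : Omega * Omega => dotv (K w.1 w.2) (Z w.1)).
  under eq_fun do rewrite dotvE.
  apply: measurable_sum => i; apply: measurable_funM; first exact: mK.
  by apply: measurable_wrt_coord; exact: measurable_wrt_fst.
have iq : PP.-integrable setT (EFin \o (fun w => dotv (K w.1 w.2) (Z w.1))).
  apply: (@dominated_integrableR _ _ _ _ _ (fun w => 2 * d%:R ^+ 2 * C *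
    (dotv (Z w.1) (Z w.1) + dotv (Z w.2) (Z w.2)))) => //.
    apply: integrableR_Z; apply: integrableR_D; first exact: (integrable_fst P _ iZZ).
    exact: (integrable_snd P _ iZZ).
  by move=> w; exact: (dotv_pair_drift_bound _ _ _ bG1 bG2).
pose m := \int[P]_w N w.
have N0 w : 0 <= N w by rewrite addr_ge0// dotvv_ge0.
have m0 : 0 <= m by apply: Rintegral_ge0.
have [C0 _ _] := bG1.
have dC0 : 0 <= d%:R * C by rewrite mulr_ge0.
have boundV w i : `|mean_pair_drift w 0 i| <= d%:R * C * (enorm (Z w) + m).
  rewrite mxE (le_trans (le_normr_Rintegral measurableT (integrable_K2 i w)))//.
  have iEN : P.-integrable setT (EFin \o (fun w' => enorm (Z w) + N w')).
    apply: integrableR_D => //.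
    exact: (finite_measure_integrable_cst P (enorm (Z w)) measurableT).
  apply: (@le_trans _ _ (\int[P]_w' (d%:R * C * (enorm (Z w) + N w')))).
    apply: le_Rintegral => //; last 2 first.
    - exact: (integrableR_Z P _ _ iEN).
    - move=> w' _; apply: le_trans (pair_drift_bound _ _ _ bG1 bG2 _ _ _ _ _) _.
      by rewrite ler_wpM2l// lerD2l.
    by have := integrable_abse (integrable_K2 i w); apply: eq_integrable.
  rewrite RintegralZl// RintegralD//; last first.
    exact: (finite_measure_integrable_cst P (enorm (Z w)) measurableT).
  by rewrite Rintegral_cst//= probability_setT mulr1.
have iM : sqint P measurable mean_pair_drift.
  have mM := measurable_wrt_sub _ mV.
  apply/sqintP; split => //.
  apply: (@dominated_integrableR _ _ _ _ _ (fun w => d%:R * (d%:R * C) ^+ 2 *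
     (2 * (dotv (Z w) (Z w) + m ^+ 2)))); first exact: measurable_dotv.
    apply: integrableR_Z; apply: integrableR_Z; apply: integrableR_D => //.
    exact: (finite_measure_integrable_cst P (m ^+ 2) measurableT).
  move=> w; rewrite ger0_norm ?dotvv_ge0// dotvE -enorm_sqr.
  have E0 := enorm_ge0 (Z w).
  apply: (@le_trans _ _ (\sum_(i < d) (d%:R * C * (enorm (Z w) + m)) ^+ 2)).
    apply: ler_sum => i _; rewrite -expr2 -real_normK ?num_real//.
    by rewrite ler_pXn2r ?nnegrE// mulr_ge0// addr_ge0.
  rewrite sumr_const card_ord -[_ *+ d]mulr_natl exprMn [leLHS]mulrA ler_wpM2l//.
    by rewrite mulr_ge0// sqr_ge0.
  by have := sqr_ge0 (enorm (Z w) - m); nra.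
have mVm := measurable_wrt_sub _ mV2.
have mMm := measurable_wrt_sub _ mV.
split; [|exact: iq|].
  split; first exact: mV2.
  have eI : (\int[P]_w (enorm (V w) ^+ 2)%:E = \int[P]_w (enorm (mean_pair_drift w) ^+ 2)%:E)%E.
    apply: ge0_ae_eq_integral; first exact: measurableT.
    - by under eq_fun do rewrite enorm_sqr; apply/measurable_EFinP/measurable_dotv.
    - by under eq_fun do rewrite enorm_sqr; apply/measurable_EFinP/measurable_dotv.
    - by move=> w _; rewrite lee_fin sqr_ge0.
    - by move=> w _; rewrite lee_fin sqr_ge0.
    - by apply: filterS aeV => w Vw _; rewrite Vw.
  by rewrite eI; case: iM.
have -> : hdot P Z V = hdot P Z mean_pair_drift.
  congr fine; apply: ae_eq_integral => //.
  - by apply/measurable_EFinP/measurable_dotv.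
  - by apply/measurable_EFinP/measurable_dotv.
  - by apply: filterS aeV => w Vw _; rewrite Vw.
have iZK i w : P.-integrable setT (EFin \o (fun w' => K w w' 0 i * Z w 0 i)).
  have := integrableR_Z P (Z w 0 i) _ (integrable_K2 i w).
  by apply: eq_integrable => // w' _; rewrite /= mulrC.
have innerE w : \int[P]_w' dotv (K w w') (Z w) = dotv (Z w) (mean_pair_drift w).
  have e i : (\int[P]_w' (K w w' 0 i * Z w 0 i)%:E = (Z w 0 i * mean_pair_drift w 0 i)%:E)%E.
    rewrite -[LHS]fineK; last exact: integrable_fin_num (iZK i w).
    rewrite mxE -(RintegralZl _ measurableT (integrable_K2 i w)).
    by congr (fine _)%:E; apply: eq_integral => w' _; rewrite mulrC.
  rewrite dotvE /Rintegral; under eq_integral do rewrite dotvE -sumEFin.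
  rewrite (integral_sum measurableT (fun i => iZK i w)).
  rewrite (eq_bigr (fun i => (Z w 0 i * mean_pair_drift w 0 i)%:E)) ?sumEFin//.
  by move=> i _; exact: e.
have iqw w : P.-integrable setT (EFin \o (fun w' => dotv (K w w') (Z w))).
  have := integrable_sum measurableT (index_enum _) (P := xpredT) (fun i _ => iZK i w).
  by apply: eq_integrable => // w' _; rewrite /= dotvE -sumEFin.
have [_ /esym eq_fub] := Rintegral_fubini P _ iq iqw.
apply: etrans eq_fub; apply: eq_Rintegral => w _.
exact/esym/innerE.
Qed.

End conditional_drift.

(** * Gradients of the drift *)

Section gradients.
Context {R : realType} {d : nat}.
Local Notation Rd := 'rV[R]_d.
Variable b : R -> Rd * Rd -> Rd.

Lemma grad1_derive t x1 x2 k i : differentiable (b t) (x1, x2) ->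
  grad1 b t x1 x2 k i = 'D_(delta_mx 0 k, 0) (b t) (x1, x2) 0 i.
Proof.
move=> db.
have dpart : differentiable (fun y : Rd => b t (y, x2)) x1.
  have dp : differentiable (fun y : Rd => (y, x2) : Rd * Rd) x1.
    apply: (@differentiable_pair R Rd Rd Rd (fun y : Rd => y) (fun=> x2)) => //.
  exact: (@differentiable_comp R Rd _ _ (fun y : Rd => (y, x2) : Rd * Rd) (b t)).
have := deriveEjacobian (delta_mx 0 k) dpart.
move=> /(congr1 (fun v : Rd => v 0 i)).
rewrite -rowE mxE -/(grad1 b t x1 x2) => <-; congr (fun_of_matrix _ 0 i).
have quotE : (fun h : R => h^-1 *: (((fun y => b t (y, x2)) \o shift x1) (h *: delta_mx 0 k) - b t (x1, x2))) =
    (fun h : R => h^-1 *: ((b t \o shift (x1, x2)) (h *: ((delta_mx 0 k, 0) : Rd * Rd)) - b t (x1, x2))).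
  apply/funext => h /=; congr (_ *: (b t _ - _)).
  by congr pair; rewrite /= scaler0 add0r.
by rewrite /derive quotE.
Qed.

Lemma grad2_derive t x1 x2 k i : differentiable (b t) (x1, x2) ->
  grad2 b t x1 x2 k i = 'D_(0, delta_mx 0 k) (b t) (x1, x2) 0 i.
Proof.
move=> db.
have dpart : differentiable (fun y : Rd => b t (x1, y)) x2.
  have dp : differentiable (fun y : Rd => (x1, y) : Rd * Rd) x2.
    apply: (@differentiable_pair R Rd Rd Rd (fun=> x1) (fun y : Rd => y)) => //.
  exact: (@differentiable_comp R Rd _ _ (fun y : Rd => (x1, y) : Rd * Rd) (b t)).
have := deriveEjacobian (delta_mx 0 k) dpart.
move=> /(congr1 (fun v : Rd => v 0 i)).
rewrite -rowE mxE -/(grad2 b t x1 x2) => <-; congr (fun_of_matrix _ 0 i).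
have quotE : (fun h : R => h^-1 *: (((fun y => b t (x1, y)) \o shift x2) (h *: delta_mx 0 k) - b t (x1, x2))) =
    (fun h : R => h^-1 *: ((b t \o shift (x1, x2)) (h *: ((0, delta_mx 0 k) : Rd * Rd)) - b t (x1, x2))).
  apply/funext => h /=; congr (_ *: (b t _ - _)).
  by congr pair; rewrite /= scaler0 add0r.
by rewrite /derive quotE.
Qed.

Hypothesis hb : smooth_bounded_derivatives b.

(** The rows of the gradient matrices are the derivatives of [b t] in the coordinate
    directions, which the hypothesis bounds one direction at a time. *)
Lemma gradient_bounded_kernel : exists C : R, forall t, 0 <= t ->
  bounded_kernel C (grad1 b t) /\ bounded_kernel C (grad2 b t).
Proof.
have [smooth bnd] := hb.
have db t z : 0 <= t -> differentiable (b t) z by move=> t0; exact: (smooth t [::] z t0).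
have /choice[C1 hC1] (k : 'I_d) := bnd [:: (delta_mx 0 k, 0)] isT.
have /choice[C2 hC2] (k : 'I_d) := bnd [:: (0, delta_mx 0 k)] isT.
exists (\sum_k `|C1 k| + \sum_k `|C2 k|) => t t0.
have S1 : 0 <= \sum_k `|C1 k| by exact: sumr_ge0.
have S2 : 0 <= \sum_k `|C2 k| by exact: sumr_ge0.
have le1 k : C1 k <= \sum_k `|C1 k| + \sum_k `|C2 k|.
  rewrite (le_trans (ler_norm _))// (bigD1 k)//= -addrA lerDl addr_ge0//.
  exact: sumr_ge0.
have le2 k : C2 k <= \sum_k `|C1 k| + \sum_k `|C2 k|.
  rewrite (le_trans (ler_norm _))// [X in _ + X](bigD1 k)//= addrCA lerDl addr_ge0//.
  exact: sumr_ge0.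
have coordN (v : Rd) i : `|v 0 i| <= `|v|.
  by rewrite [leRHS]/Num.norm /= mx_normrE; apply/bigmax_geP; right; exists (0, i).
split; split; rewrite ?addr_ge0//.
- move=> k i p.
  rewrite (_ : (fun p => _) = (fun M : Rd => M 0 i) \o
      iter_derive (b t) [:: (delta_mx 0 k, 0)]); last first.
    by apply/funext => -[x1 x2]; rewrite /= grad1_derive//; exact: db.
  apply: continuous_comp; last exact: coord_continuous.
  exact/differentiable_continuous/smooth.
- move=> x x' k i; rewrite grad1_derive; last exact: db.
  exact: le_trans (coordN _ _) (le_trans (hC1 k t (x, x') t0) (le1 k)).
- move=> k i p.
  rewrite (_ : (fun p => _) = (fun M : Rd => M 0 i) \o
      iter_derive (b t) [:: (0, delta_mx 0 k)]); last first.
    by apply/funext => -[x1 x2]; rewrite /= grad2_derive//; exact: db.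
  apply: continuous_comp; last exact: coord_continuous.
  exact/differentiable_continuous/smooth.
- move=> x x' k i; rewrite grad2_derive; last exact: db.
  exact: le_trans (coordN _ _) (le_trans (hC2 k t (x, x') t0) (le2 k)).
Qed.

Lemma dotv_mul_row_block (z z' : Rd) (A B C D : 'M[R]_d) :
  dotv (z *m A + z' *m C) z + dotv (z' *m D + z *m B) z' =
  dotv (row_mx z z' *m block_mx A B C D) (row_mx z z').
Proof.
rewrite mul_row_block /dotv tr_row_mx mul_row_col [RHS]mxE.
by rewrite [z *m B + _]addrC.
Qed.

Lemma pair_drift_Amx t x z x' z' :
  dotv (pair_drift (grad1 b t) (grad2 b t) x z x' z') z +
  dotv (pair_drift (grad1 b t) (grad2 b t) x' z' x z) z' =
  dotv (row_mx z z' *m Amx b t x x') (row_mx z z').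
Proof.
exact: dotv_mul_row_block.
Qed.

Lemma dotv_mxsym {n} (v : 'rV[R]_n) (A : 'M[R]_n) :
  dotv (v *m mxsym A) v = dotv (v *m A) v.
Proof.
rewrite /mxsym -scalemxAr dotvZl mulmxDr dotvDl.
have -> : dotv (v *m A^T) v = dotv (v *m A) v.
  have trE : v *m A^T *m v^T = (v *m A *m v^T)^T by rewrite !trmx_mul !trmxK mulmxA.
  by rewrite /dotv trE mxE.
lra.
Qed.

(** Adding the form with the two copies exchanged makes the matrix [A_t] appear. *)
Lemma condH_pair_drift lambda0 t x z x' z' : condH b lambda0 -> 0 <= t ->
  dotv (pair_drift (grad1 b t) (grad2 b t) x z x' z') z +
  dotv (pair_drift (grad1 b t) (grad2 b t) x' z' x z) z' <=
  - lambda0 * (dotv z z + dotv z' z').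
Proof.
move=> [_ [l1 [_ h]]] t0; have [+ _] := h t x x' t0.
move=> /(_ (row_mx z z')); rewrite dotv_mxsym -pair_drift_Amx => /le_trans; apply.
by rewrite mul_mx_scalar dotvZl /dotv tr_row_mx mul_row_col [X in _ * X <= _]mxE.
Qed.

End gradients.

(** * Quadratic form and logarithmic norm of the differential of the drift *)

Section operators.
Context {R : realType} {d : nat} {dO : measure_display} {Omega : measurableType dO}.
Variables (P : probability Omega R) (F : R -> set (set Omega)).
Variable b : R -> 'rV[R]_d * 'rV[R]_d -> 'rV[R]_d.
Hypotheses (hF : filtration F) (hb : smooth_bounded_derivatives b).
Local Notation Rd := 'rV[R]_d.
Local Notation PP := (P \x P)%E.
Implicit Types (X Z V U Y : Omega -> Rd) (T : (Omega -> Rd) -> (Omega -> Rd)).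

Lemma inH_sqint t Z : 0 <= t -> inH P F t Z -> sqint P measurable Z.
Proof.
move=> t0 [mZ iZ]; split => //; have [_ Fm] := hF.1 t t0.
by move=> B mB; exact/Fm/mZ.
Qed.

Lemma inHZ t (a : R) Z : 0 <= t -> inH P F t Z -> inH P F t (fun w => a *: Z w).
Proof.
move=> t0 iZ; split; last by case: (sqintZ _ a _ (inH_sqint _ _ t0 iZ)).
have [sF _] := hF.1 t t0; have := iZ.1; rewrite -(measurable_TG _ sF) => mZ.
apply: coord_measurable_wrt => i; under eq_fun do rewrite mxE.
by apply: measurable_funM => //; exact: measurable_wrt_coord.
Qed.

(** The quadratic form whose integral over the product space is [<Z, dB Z>]. *)
Definition pair_form t X Z (w : Omega * Omega) : R :=
  dotv (pair_drift (grad1 b t) (grad2 b t) (X w.1) (Z w.1) (X w.2) (Z w.2)) (Z w.1).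

(** [mean_pair_drift] witnesses that [dB] is not its default value, and uniqueness
    transfers its properties to [dB]. *)
Lemma dB_spec t X Z : 0 <= t -> measurable_wrt (F t) X -> inH P F t Z ->
  [/\ inH P F t (dB P F b t X Z),
      PP.-integrable setT (EFin \o pair_form t X Z) &
      hdot P Z (dB P F b t X Z) = \int[PP]_w pair_form t X Z w].
Proof.
move=> t0 mX iZ; have [C /(_ t t0)[bG1 bG2]] := gradient_bounded_kernel _ hb.
have [sF Fm] := hF.1 t t0.
apply: (condexp_hdot P (F t) sF Fm _ _ C bG1 bG2 X Z mX iZ).
have ex : exists V, [set V | is_dB P F b t X Z V] V.
  exists (mean_pair_drift P (grad1 b t) (grad2 b t) X Z).
  exact: (mean_pair_drift_condexp P (F t) sF Fm _ _ C bG1 bG2 X Z mX iZ).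
exact: (xgetPex (fun=> 0) ex).
Qed.

(** If there is an adjoint [S], then [<Z, S Z> = <T Z, Z>]; otherwise [adjoint] is [T].
    In both cases the symmetric part has the same quadratic form as [T]. *)
Lemma hdot_opsym t T Z : 0 <= t -> inH P F t Z -> inH P F t (T Z) ->
  hdot P Z (opsym P F t T Z) = hdot P Z (T Z).
Proof.
move=> t0 iZ iTZ; rewrite /opsym /adjoint.
have sZ := inH_sqint _ _ t0 iZ; have sTZ := inH_sqint _ _ t0 iTZ.
case: xgetP => [S _ [HS adjS]|_].
  have sSZ := inH_sqint _ _ t0 (HS _ iZ).
  rewrite (hdotZr P _ _ _ sZ (sqintD P _ _ sTZ sSZ)) (hdotDr P _ _ _ sZ sTZ sSZ).
  rewrite -(adjS _ _ iZ iZ) (hdotC P (T Z)); lra.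
rewrite (hdotZr P _ _ _ sZ (sqintD P _ _ sTZ sTZ)) (hdotDr P _ _ _ sZ sTZ sTZ); lra.
Qed.

Lemma hdot_le_gamma t T Z : 0 <= t -> inH P F t Z -> inH P F t (T Z) -> hnorm P Z = 1 ->
  ((hdot P Z (T Z))%:E <= gamma P F t T)%E.
Proof.
by move=> t0 iZ iTZ Z1; apply: ereal_sup_ubound; exists Z => //; rewrite hdot_opsym.
Qed.

Lemma pair_formZ t X Z a w : pair_form t X (fun w => a *: Z w) w = a ^+ 2 * pair_form t X Z w.
Proof.
by rewrite /pair_form /pair_drift -!scalemxAl -scalerDr dotvZl dotvZr mulrA expr2.
Qed.

Lemma inH_opopp t T Z : 0 <= t -> inH P F t (T Z) -> inH P F t (opopp T Z).
Proof.
move=> t0 /(inHZ _ (-1) _ t0); rewrite /opopp.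
by under [X in inH _ _ _ X]eq_fun do rewrite scaleN1r.
Qed.

Lemma hdot_opopp t T Z : 0 <= t -> inH P F t Z -> inH P F t (T Z) ->
  hdot P Z (opopp T Z) = - hdot P Z (T Z).
Proof.
move=> t0 iZ iTZ; have sZ := inH_sqint _ _ t0 iZ; have sTZ := inH_sqint _ _ t0 iTZ.
rewrite -mulN1r -(hdotZr P _ _ _ sZ sTZ).
by congr hdot; apply/funext => w; rewrite scaleN1r.
Qed.

(** The operator [dB] is homogeneous only up to almost sure equality, so the
    normalization of [U] is carried out on the form [pair_form]. *)
Lemma rayleigh_le_gamma t X U : 0 <= t -> measurable_wrt (F t) X -> inH P F t U ->
  0 < hdot P U U ->
  ((hdot P U (dB P F b t X U) / hdot P U U)%:E <= gamma P F t (dB P F b t X))%E /\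
  ((- (hdot P U (dB P F b t X U) / hdot P U U))%:E <= gamma P F t (opopp (dB P F b t X)))%E.
Proof.
move=> t0 mX iU U0; pose a := (hnorm P U)^-1; pose Z w := a *: U w.
have nU0 : 0 < hnorm P U by rewrite sqrtr_gt0.
have iZ : inH P F t Z by exact: inHZ.
have sU := inH_sqint _ _ t0 iU.
have Z1 : hnorm P Z = 1.
  rewrite /hnorm (hdotZl P a _ _ (sqintZ _ a _ sU) sU) (hdotZr P a _ _ sU sU).
  by rewrite mulrA -expr2 -hnorm_sqr -exprMn mulVf ?gt_eqF// expr1n sqrtr1.
have [iTZ _ eZ] := dB_spec _ _ _ t0 mX iZ.
have [_ iq eU] := dB_spec _ _ _ t0 mX iU.
have e : hdot P Z (dB P F b t X Z) = hdot P U (dB P F b t X U) / hdot P U U.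
  rewrite eZ eU mulrC -(RintegralZl (mu := PP) _ measurableT iq).
  apply: eq_Rintegral => w _; rewrite pair_formZ; congr (_ * _).
  by rewrite -hnorm_sqr exprVn.
rewrite -e; split; first exact: hdot_le_gamma.
rewrite -(hdot_opopp t _ _ t0 iZ iTZ).
exact: (hdot_le_gamma t _ _ t0 iZ (inH_opopp _ _ _ t0 iTZ) Z1).
Qed.

Lemma integrable_sqnorm_pair Z : sqint P measurable Z ->
  PP.-integrable setT (EFin \o (fun w => dotv (Z w.1) (Z w.1) + dotv (Z w.2) (Z w.2))) /\
  \int[PP]_w (dotv (Z w.1) (Z w.1) + dotv (Z w.2) (Z w.2)) = 2 * hdot P Z Z.
Proof.
move=> /sqintP[_ iZ].
have i1 := integrable_fst P _ iZ; have i2 := integrable_snd P _ iZ.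
split; first exact: integrableR_D.
rewrite (RintegralD (mu := PP) measurableT i1 i2).
rewrite (Rintegral_fst P _ iZ) (Rintegral_snd P _ iZ) /hdot; lra.
Qed.

(** The constant is uniform in time and in the base point, since the gradients of [b]
    are. *)
Lemma hdot_dB_bound : exists K : R, forall t X Z, 0 <= t -> measurable_wrt (F t) X ->
  inH P F t Z -> `|hdot P Z (dB P F b t X Z)| <= K * hdot P Z Z.
Proof.
have [C hC] := gradient_bounded_kernel _ hb.
exists (2 * d%:R ^+ 2 * C * 2) => t X Z t0 mX iZ.
have [bG1 bG2] := hC t t0; have [_ iq ->] := dB_spec _ _ _ t0 mX iZ.
have [iN eN] := integrable_sqnorm_pair _ (inH_sqint _ _ t0 iZ).
apply: le_trans (le_normr_Rintegral (mu := PP) measurableT iq) _.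
rewrite -[leRHS]mulrA -eN -(RintegralZl (mu := PP) _ measurableT iN).
apply: le_Rintegral => //.
- by have := integrable_abse iq; apply: eq_integrable.
- exact: integrableR_Z.
- by move=> w _; exact: (dotv_pair_drift_bound _ _ _ bG1 bG2).
Qed.

(** The integral of [pair_form] is unchanged by the exchange of the copies, so twice
    this integral is that of the symmetrized form, controlled by [condH_pair_drift]. *)
Lemma condH_gamma lambda0 t X : condH b lambda0 -> 0 <= t -> measurable_wrt (F t) X ->
  (gamma P F t (dB P F b t X) <= (- lambda0)%:E)%E.
Proof.
move=> hH t0 mX; apply: ge_ereal_sup => _ [Z [iZ Z1] <-].
have [iTZ iq eZ] := dB_spec _ _ _ t0 mX iZ.
rewrite hdot_opsym// lee_fin eZ.
have [iN eN] := integrable_sqnorm_pair _ (inH_sqint _ _ t0 iZ).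
have swapE := Rintegral_swap P _ iq.
have iqs := integrable_swap P _ iq.
suff : \int[PP]_w pair_form t X Z w + \int[PP]_w pair_form t X Z (w.2, w.1) <= - lambda0 * 2.
  rewrite -swapE; lra.
rewrite -(RintegralD (mu := PP) measurableT iq iqs).
rewrite (_ : - lambda0 * 2 = - lambda0 * (2 * hdot P Z Z)); last first.
  by rewrite -hnorm_sqr Z1; ring.
rewrite -eN -(RintegralZl (mu := PP) _ measurableT iN).
apply: le_Rintegral => //.
- exact: integrableR_D.
- exact: integrableR_Z.
- by move=> w _; exact: condH_pair_drift.
Qed.

(** Replace [X] by zero where its norm exceeds [n]. At each point the form
    [pair_form] is eventually unchanged, and it is dominated by a multiple of
    [|Z|^2 + |Z'|^2], so its integral converges. *)
Lemma truncation_gamma (c : R) t X : 0 <= t ->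
  (forall Y, inH P F t Y -> (gamma P F t (dB P F b t Y) <= c%:E)%E) ->
  measurable_wrt (F t) X -> (gamma P F t (dB P F b t X) <= c%:E)%E.
Proof.
move=> t0 hY mX; have [sF Fm] := hF.1 t t0.
apply: ge_ereal_sup => _ [Z [iZ Z1] <-].
have [iTZ iq eZ] := dB_spec _ _ _ t0 mX iZ.
rewrite hdot_opsym// lee_fin eZ.
pose A (n : nat) := [set w | enorm (X w) <= n%:R].
pose Xn n w := (\1_(A n) w : R) *: X w.
have mA n : (measurable : set (set (g_sigma_algebraType (F t)))) (A n).
  have mX' := measurable_wrt_TG _ sF X mX.
  have mE : measurable_fun (setT : set (g_sigma_algebraType (F t))) (fun w => dotv (X w) (X w)).
    exact: measurable_dotv.
  have := mE measurableT `]-oo, n%:R ^+ 2]%classic (measurable_itv _).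
  rewrite setTI; congr (measurable _); apply/seteqP; split => w; rewrite /A/= in_itv/= -enorm_sqr;
    by rewrite ler_pXn2r ?nnegrE ?enorm_ge0.
have mXn n : measurable_wrt (F t) (Xn n).
  have mX' := measurable_wrt_TG _ sF X mX; rewrite -(measurable_TG _ sF).
  apply: coord_measurable_wrt => i; under eq_fun do rewrite mxE.
  apply: measurable_funM; last exact: measurable_wrt_coord.
  exact: measurable_indic.
have iXn n : inH P F t (Xn n).
  split => //.
  have : sqint P measurable (Xn n).
    apply/sqintP; split; first by move=> B mB; exact/Fm/mXn.
    apply: (@dominated_integrableR _ _ _ P _ (fun=> n%:R ^+ 2)).
    - by apply: measurable_dotv => B mB; exact/Fm/mXn.
    - exact: (finite_measure_integrable_cst P (n%:R ^+ 2) measurableT).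
    - move=> w; rewrite ger0_norm ?dotvv_ge0// -enorm_sqr ler_pXn2r ?nnegrE ?enorm_ge0//.
      rewrite /Xn indicE; case: (boolP (w \in A n)) => [/set_mem|_].
        by rewrite scale1r.
      by rewrite scale0r /enorm /dotv mul0mx mxE sqrtr0.
  by case.
have qn n : \int[PP]_w pair_form t (Xn n) Z w <= c.
  have [iTZn _ <-] := dB_spec _ _ _ t0 (mXn n) iZ.
  by rewrite -lee_fin; apply: le_trans (hdot_le_gamma t _ _ t0 iZ iTZn Z1) (hY _ (iXn n)).
have [C hC] := gradient_bounded_kernel _ hb; have [bG1 bG2] := hC t t0.
have [iN _] := integrable_sqnorm_pair _ (inH_sqint _ _ t0 iZ).
have iqn n : PP.-integrable setT (EFin \o pair_form t (Xn n) Z).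
  by have [] := dB_spec _ _ _ t0 (mXn n) iZ.
have XnE n w : enorm (X w) <= n%:R -> Xn n w = X w.
  by move=> nw; rewrite /Xn indicE mem_set// scale1r.
have cvgq w : pair_form t (Xn n) Z w @[n --> \oo] --> pair_form t X Z w.
  apply: cvg_near_cst.
  near=> n; rewrite /pair_form !XnE//.
    near: n; exact: nbhs_infty_ger.
  near: n; exact: nbhs_infty_ger.
pose bd (w : Omega * Omega) : R := 2 * d%:R ^+ 2 * C *
  (dotv (Z w.1) (Z w.1) + dotv (Z w.2) (Z w.2)).
have bq : PP.-integrable setT (EFin \o bd) by exact: integrableR_Z.
have aecvg : {ae PP, forall w, setT w -> (EFin \o pair_form t (Xn n) Z) w @[n --> \oo] -->
    (EFin \o pair_form t X Z) w}.
  by apply: aeW => w _; apply: cvg_EFin; [exact: nearW|exact: cvgq].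
have aebound : {ae PP, forall w n, setT w -> (`|(EFin \o pair_form t (Xn n) Z) w| <=
    (EFin \o bd) w)%E}.
  by apply: aeW => w n _; rewrite lee_fin; exact: (dotv_pair_drift_bound _ _ _ bG1 bG2).
have [_ _ cvgI] := @dominated_convergence _ _ R PP setT measurableT _ _ _
  (fun n => measurable_int _ (iqn n)) (measurable_int _ iq) aecvg bq aebound.
rewrite -lee_fin /Rintegral fineK; last exact: integrable_fin_num iq.
rewrite -(cvg_lim _ cvgI)//; apply: lime_le; first exact: cvgP cvgI.
apply: nearW => n; have := qn n; rewrite -lee_fin /Rintegral fineK//.
exact: integrable_fin_num (iqn n).
Unshelve. all: by end_near. Qed.

End operators.

(** * Derivative of the square norm of a curve *)

Section one_sided_quotient.
Context {R : realType}.
Variables (f : R -> R) (s : R).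
Local Notation after := [set r : R | s <= r].

Lemma within_quotientP (u l : R) :
  ((f r - f u) / (r - u)) @[r --> within after u^'] --> l ->
  forall e, 0 < e -> exists2 dl, 0 < dl &
    forall r, s <= r -> r != u -> `|u - r| < dl -> `|l - (f r - f u) / (r - u)| <= e.
Proof.
move=> /cvgrPdist_le h e e0; have := h e e0.
rewrite !near_withinE => /nbhs_ballP[dl /= dl0 H]; exists dl => // r sr ru ur.
exact: H.
Qed.

Lemma within_quotient_is_derive (u l : R) : s < u ->
  ((f r - f u) / (r - u)) @[r --> within after u^'] --> l -> is_derive u 1 f l.
Proof.
move=> su /within_quotientP h.
suff c : (fun e => e^-1 *: ((f \o shift u) (e *: 1) - f u)) e @[e --> 0^'] --> l.
  by apply: DeriveDef; [exact: cvgP c|exact: cvg_lim c].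
apply/cvgrPdist_le => e e0; have [dl dl0 H] := h e e0.
exists (Num.min dl (u - s)); rewrite /= ?lt_min ?dl0 ?subr_gt0// => v /=.
rewrite sub0r normrN lt_min => /andP[vd vs] v0; rewrite scaler1.
have := H (v + u); rewrite addrK opprD addrCA subrr addr0 normrN => Hv.
rewrite /= /GRing.scale/= mulrC; apply: Hv => //.
  by move: vs; rewrite ltr_norml => /andP[]; lra.
by rewrite -subr_eq0 addrK.
Qed.

(** The quotient is bounded near [u], so [f] is Lipschitz at [u]; at [s] only the right
    neighbourhood counts. *)
Lemma within_quotient_continuous (t : R) (l : R -> R) :
  (forall u, s <= u <= t -> ((f r - f u) / (r - u)) @[r --> within after u^'] --> l u) ->
  {within `[s, t], continuous f}.
Proof.
move=> h; apply/subspace_continuousP => u /=; rewrite in_itv/= => sut.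
have [dl dl0 H] := within_quotientP _ _ (h u sut) 1 ltr01.
apply/cvgrPdist_le => e e0; rewrite near_withinE.
have L0 : 0 < `|l u| + 1 by rewrite ltr_pwDr.
exists (Num.min dl (e / (`|l u| + 1))); rewrite /= ?lt_min ?dl0 ?divr_gt0// => r /=.
rewrite lt_min => /andP[rd re]; rewrite in_itv/= => /andP[sr rt].
have [->|ru] := eqVneq r u; first by rewrite subrr normr0 ltW.
have := H r sr ru rd => Hq.
have ru0 : r - u != 0 by rewrite subr_eq0.
rewrite distrC -[f r - f u](divfK ru0) normrM.
have : `|(f r - f u) / (r - u)| <= `|l u| + 1.
  have := ler_normB (l u) (l u - (f r - f u) / (r - u)); rewrite opprB addrC subrK.
  by move=> /le_trans; apply; rewrite lerD2l.
move=> q1; apply: (@le_trans _ _ ((`|l u| + 1) * `|r - u|)); first by rewrite ler_wpM2r.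
by rewrite mulrC -ler_pdivlMr// distrC ltW.
Qed.

End one_sided_quotient.

Section L2_derivative.
Context {R : realType} {d : nat} {dO : measure_display} {Omega : measurableType dO}.
Variable P : probability Omega R.
Local Notation Rd := 'rV[R]_d.
Local Notation L2 Z := (sqint P (measurable : set (set Omega)) (Z : Omega -> Rd)).

(** With [E] the error in the difference quotient, [V r = V t + (r - t) (A + E)];
    expand the square and use the Cauchy-Schwarz inequality on the terms with [E]. *)
Lemma hdot_sqr_quotient_cvg (V : R -> Omega -> Rd) (A : Omega -> Rd) (S : set R) (t : R) :
  S t -> (forall r, S r -> L2 (V r)) -> L2 A ->
  hnorm P (fun w => (r - t)^-1 *: (V r w - V t w) - A w) @[r --> within S t^'] --> (0 : R) ->
  ((hdot P (V r) (V r) - hdot P (V t) (V t)) / (r - t)) @[r --> within S t^']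
    --> 2 * hdot P (V t) A.
Proof.
move=> St iV iA; set e := (fun r => hnorm P _) => e0.
pose bound r := 2 * hnorm P (V t) * e r + `|r - t| * (hnorm P A + e r) ^+ 2.
have b0 : bound r @[r --> within S t^'] --> 0.
  rewrite (_ : 0 = 2 * hnorm P (V t) * 0 + `|t - t| * (hnorm P A + 0) ^+ 2); last first.
    by rewrite subrr normr0 mul0r mulr0 addr0.
  apply: cvgD; first by apply: cvgM => //; exact: cvg_cst.
  apply: cvgM.
    apply: cvg_norm; apply: cvgB; last exact: cvg_cst.
    by apply: cvg_within_filter; apply: cvg_within.
  rewrite expr2; under eq_fun do rewrite expr2.
  by apply: cvgM; apply: cvgD => //; exact: cvg_cst.
suff key r : S r -> r != t ->
    `|2 * hdot P (V t) A - (hdot P (V r) (V r) - hdot P (V t) (V t)) / (r - t)| <= bound r.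
  apply/cvgrPdist_le => eps eps0.
  move/cvgrPdist_le : b0 => /(_ eps eps0); rewrite !near_withinE.
  apply: filterS => r + rt Sr => /(_ rt Sr).
  by rewrite sub0r normrN => /(le_trans (ler_norm _)); exact/le_trans/key.
move=> Sr rt.
have iVt := iV _ St.
pose E w := (r - t)^-1 *: (V r w - V t w) - A w.
have iE : L2 E.
  have -> : E = (fun w => ((r - t)^-1 *: V r w + (- (r - t)^-1) *: V t w) + (-1) *: A w).
    by apply/funext => w; rewrite /E scalerBr scaleNr scaleN1r.
  have iV1 := sqintZ P (r - t)^-1 _ (iV r Sr).
  exact: (sqintD P _ _ (sqintD P _ _ iV1 (sqintZ P _ _ iVt)) (sqintZ P _ _ iA)).
have iAE := sqintD P _ _ iA iE.
have rt0 : r - t != 0 by rewrite subr_eq0.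
have VrE : V r = (fun w => V t w + (r - t) *: (A w + E w)).
  apply/funext => w; rewrite /E [A w + _]addrC subrK scalerA mulfV// scale1r.
  by rewrite addrC subrK.
have irAE := sqintZ P (r - t) _ iAE.
have eq1 : hdot P (V r) (V r) = hdot P (V t) (V t) +
    (r - t) * (2 * (hdot P (V t) A + hdot P (V t) E)) +
    (r - t) ^+ 2 * hdot P (fun w => A w + E w) (fun w => A w + E w).
  rewrite VrE (hdotDl P _ _ _ (sqintD P _ _ iVt irAE) iVt irAE).
  rewrite (hdotDr P _ _ _ iVt iVt irAE) (hdotDr P _ _ _ irAE iVt irAE).
  rewrite (hdotC P _ (V t)) !(hdotZr P _ _ _ iVt iAE) (hdotZl P _ _ _ irAE iAE).
  rewrite (hdotZr P _ _ _ iAE iAE) (hdotDr P _ _ _ iVt iA iE); ring.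
have -> : (hdot P (V r) (V r) - hdot P (V t) (V t)) / (r - t) =
    2 * (hdot P (V t) A + hdot P (V t) E) +
    (r - t) * hdot P (fun w => A w + E w) (fun w => A w + E w).
  by rewrite eq1; field.
have csVE := hdot_CauchySchwarz P _ _ iVt iE.
have csAE := hdot_CauchySchwarz P _ _ iA iE.
have sqAE : `|hdot P (fun w => A w + E w) (fun w => A w + E w)| <= (hnorm P A + e r) ^+ 2.
  rewrite ger0_norm ?hdot_ge0// (hdotDl P _ _ _ iAE iA iE).
  rewrite (hdotDr P _ _ _ iA iA iE) (hdotDr P _ _ _ iE iA iE) (hdotC P E A).
  rewrite sqrrD !hnorm_sqr -/E; move: csAE; rewrite ler_norml => /andP[_].
  by move=> le_cs; rewrite mulr2n !addrA lerD2r -!addrA lerD2l lerD.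
rewrite [X in `|X|](_ : _ = - (2 * hdot P (V t) E) -
    (r - t) * hdot P (fun w => A w + E w) (fun w => A w + E w)); last by ring.
rewrite (le_trans (ler_normB _ _))// normrN !normrM lerD//; last by rewrite ler_wpM2l.
by rewrite (ger0_norm (x := 2))// -mulrA ler_wpM2l.
Qed.

End L2_derivative.

(** * Growth of the tangent process *)

Section flow_tangent.
Context {R : realType} {d : nat} {dO : measure_display} {Omega : measurableType dO}.
Variables (P : probability Omega R) (F : R -> set (set Omega)).
Variables (W : R -> Omega -> 'rV[R]_d) (b : R -> 'rV[R]_d * 'rV[R]_d -> 'rV[R]_d).
Variables (X : R -> R -> probability (borel_rV R d) R -> 'rV[R]_d -> Omega -> 'rV[R]_d)
  (phi : R -> R -> probability (borel_rV R d) R -> probability (borel_rV R d) R)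
  (Dpsi : R -> R -> (Omega -> 'rV[R]_d) -> (Omega -> 'rV[R]_d) -> (Omega -> 'rV[R]_d)).
Hypotheses (hF : filtration F) (hb : smooth_bounded_derivatives b)
  (hX : mckean_vlasov_flow P F b W X phi) (hD : tangent_process P F b X Dpsi).
Local Notation Rd := 'rV[R]_d.
Implicit Types (Y U : Omega -> Rd).

(** The flow starting from [law P Y] is controlled only for laws with a finite second
    moment. *)
Lemma law_P2 s Y : 0 <= s -> inH P F s Y -> P2 (law P (Y : Omega -> borel_rV R d)).
Proof.
move=> s0 iY; have [mY iY2] := inH_sqint _ _ hF _ _ s0 iY.
have mY' : measurable_fun setT (Y : Omega -> borel_rV R d).
  by move=> _ B mB; rewrite setTI; exact: mY.
rewrite /law; case: pselect => // mY''; rewrite /P2.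
have menorm : measurable_fun (setT : set (borel_rV R d)) (fun y => (enorm (y : Rd) ^+ 2)%:E).
  under eq_fun do rewrite enorm_sqr.
  apply/measurable_EFinP/measurable_dotv; by move=> B mB.
rewrite ge0_integral_distribution//.
by move=> y; rewrite lee_fin sqr_ge0.
Qed.

(** The composition of the jointly measurable flow with [w |-> (Y w, w)]. *)
Lemma psi_measurable s t Y : 0 <= s -> s <= t -> inH P F s Y ->
  measurable_wrt (F t) (psi P X s t Y).
Proof.
move=> s0 st iY; have t0 := le_trans s0 st; have [sF _] := hF.1 t t0.
have mX := flow_measurable hX s0 st (law_P2 _ _ s0 iY).
move=> B /mX; set D := (D in <<s _ >> D) => mD.
rewrite -(measurable_TG _ sF).
set rects := (rects in <<s rects >> _) in mD.
have mpair : measurable_fun (setT : set (g_sigma_algebraType (F t)))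
    ((fun w => (Y w, w)) : g_sigma_algebraType (F t) -> g_sigma_algebraType rects).
  apply: (@measurability _ _ _ (g_sigma_algebraType rects) _ _ rects) => //.
  move=> _ [_ [U mU [A FA <-]] <-]; rewrite setTI.
  rewrite (_ : _ @^-1` _ = (Y @^-1` U) `&` A)//.
  rewrite (measurable_TG _ sF).
  have FYU : F t (Y @^-1` U) by apply: (hF.2 s t s0 st); exact: iY.1.
  rewrite -(measurable_TG _ sF); apply: measurableI; by rewrite (measurable_TG _ sF).
have := mpair measurableT D mD.
by rewrite setTI.
Qed.

Lemma hnorm_tangent_start s Y U : 0 <= s -> inH P F s Y -> inH P F s U ->
  hdot P (Dpsi s s Y U) (Dpsi s s Y U) = hdot P U U.
Proof.
move=> s0 iY iU; have [mD _] := inH_sqint _ _ hF _ _ s0 (tangent_inH hD s0 (lexx s) iY iU).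
have [mU _] := inH_sqint _ _ hF _ _ s0 iU.
congr fine; apply: ae_eq_integral => //.
- exact/measurable_EFinP/measurable_dotv.
- exact/measurable_EFinP/measurable_dotv.
- by apply: filterS (tangent_start hD s0 iY iU) => w Dw _; rewrite Dw.
Qed.

Section growth.
Variables (s : R) (Y U : Omega -> Rd).
Hypotheses (s0 : 0 <= s) (iY : inH P F s Y) (iU : inH P F s U).

Let f r := hdot P (Dpsi s r Y U) (Dpsi s r Y U).
Let df r := 2 * hdot P (Dpsi s r Y U) (dB P F b r (psi P X s r Y) (Dpsi s r Y U)).

Let quotient_cvg r : s <= r ->
  ((f v - f r) / (v - r)) @[v --> within [set v : R | s <= v] r^'] --> df r.
Proof.
move=> sr; have r0 := le_trans s0 sr.
apply: hdot_sqr_quotient_cvg; first exact: sr.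
- by move=> v sv; exact: (inH_sqint _ _ hF _ _ (le_trans s0 sv) (tangent_inH hD s0 sv iY iU)).
- have [idB _ _] := dB_spec P F b hF hb r _ _ r0 (psi_measurable _ _ _ s0 sr iY)
    (tangent_inH hD s0 sr iY iU).
  exact: (inH_sqint _ _ hF _ _ r0 idB).
- exact: (tangent_equation hD s0 sr iY iU).
Qed.

Lemma tangent_sqnorm_log_derivative : exists K : R, forall t, s <= t ->
  [/\ {within `[s, t], continuous f},
      forall u, u \in `]s, t[ -> is_derive u 1 f (df u) &
      forall u, u \in `]s, t[ -> `|df u| <= K * f u].
Proof.
have [K hK] := hdot_dB_bound P F b hF hb; exists (2 * K) => t st; split.
- by apply: (within_quotient_continuous _ _ _ df) => u /andP[su _]; exact: quotient_cvg.
- move=> u /[!in_itv]/= /andP[su _].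
  by apply: (within_quotient_is_derive _ s) => //; exact/quotient_cvg/ltW.
- move=> u /[!in_itv]/= /andP[/ltW su _].
  rewrite /df normrM (ger0_norm (x := 2))// -mulrA ler_wpM2l//.
  apply: hK; [exact: le_trans su|exact: psi_measurable|exact: (tangent_inH hD)].
Qed.

(** This is [exp_growth] for [- f]. *)
Lemma tangent_vanish t : s <= t -> hnorm P U = 0 -> hnorm P (Dpsi s t Y U) = 0.
Proof.
move=> st U0; have [K /(_ t st)[cf dfE dfK]] := tangent_sqnorm_log_derivative.
have fs0 : f s = 0 by rewrite /f hnorm_tangent_start// -hnorm_sqr U0 expr0n.
have := @exp_growth _ (fun r => - f r) (fun r => - df r) (- K) s t st.
rewrite fs0 oppr0 mulr0 => h.
have ft0 : f t <= 0.
  suff : 0 <= expR (- K * t) * - f t by rewrite pmulr_rge0 ?expR_gt0// oppr_ge0.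
  apply: h.
  - by move=> u; apply: cvgN; exact: cf.
  - by move=> u ust; have := @is_deriveN _ _ _ _ _ _ _ (dfE u ust).
  - by move=> u ust; have := dfK u ust; rewrite ler_norml => /andP[]; lra.
by apply/eqP; rewrite sqrtr_eq0.
Qed.

(** The witness is half the logarithmic derivative of the square norm, that is the
    Rayleigh quotient of [dB] at the tangent process. Both signs are given because
    the integral of [- h] is compared with another majorant. *)
Lemma tangent_growth t : s <= t -> 0 < hnorm P U ->
  0 < hnorm P (Dpsi s t Y U) /\
  exists h : R -> R,
    [/\ forall u, s <= u <= t ->
          ((h u)%:E <= gamma P F u (dB P F b u (psi P X s u Y)))%E /\
          ((- h u)%:E <= gamma P F u (opopp (dB P F b u (psi P X s u Y))))%E,
        (\int[lebesgue_measure]_(u in `[s, t]) (h u)%:E =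
          (ln (hnorm P (Dpsi s t Y U)) - ln (hnorm P U))%:E)%E &
        (\int[lebesgue_measure]_(u in `[s, t]) (- h u)%:E =
          (- (ln (hnorm P (Dpsi s t Y U)) - ln (hnorm P U)))%:E)%E].
Proof.
move=> st U0; have [K hK] := tangent_sqnorm_log_derivative.
have fs0 : 0 < f s by rewrite /f hnorm_tangent_start// -hnorm_sqr exprn_gt0.
have pos u : s <= u -> 0 < f u.
  move=> su; have [cf dfE dfK] := hK u su.
  by have [] := log_derivative_integral _ _ _ 1 _ _ su cf dfE dfK fs0.
have [cf dfE dfK] := hK t st.
have nE u : s <= u -> ln (f u) = 2 * ln (hnorm P (Dpsi s u Y U)).
  move=> su; have := pos u su; rewrite /f => fu.
  by rewrite -hnorm_sqr lnXn ?mulr_natl// sqrtr_gt0.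
split; first by rewrite sqrtr_gt0; exact: pos.
have lnU : ln (f s) = 2 * ln (hnorm P U).
  by rewrite /f hnorm_tangent_start// -hnorm_sqr lnXn ?mulr_natl.
exists (fun u => 2^-1 * (df u / f u)); split.
- move=> u /andP[su ut]; have u0 := le_trans s0 su.
  have := rayleigh_le_gamma P F b hF hb u _ _ u0 (psi_measurable _ _ _ s0 su iY)
     (tangent_inH hD s0 su iY iU) (pos u su).
  by rewrite /df !mulrA mulVf ?mul1r.
- have [_ ->] := log_derivative_integral _ _ _ 2^-1 _ _ st cf dfE dfK fs0.
  by rewrite nE// lnU -mulrBr mulKf.
- have [_] := log_derivative_integral _ _ _ (- 2^-1) _ _ st cf dfE dfK fs0.
  under eq_integral do rewrite mulNr.
  by move=> ->; rewrite nE// lnU -mulrBr mulNr mulKf.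
Qed.

End growth.

Lemma opnorm_upper s t Y : 0 <= s -> s <= t -> inH P F s Y ->
  (opnorm P F s (Dpsi s t Y) <=
   expeR (\int[lebesgue_measure]_(u in `[s, t]) gamma P F u (dB P F b u (psi P X s u Y))))%E.
Proof.
move=> s0 st iY; apply: ge_ereal_sup => _ [U [iU U1] <-].
have [U0|U0] := eqVneq (hnorm P U) 0.
  by rewrite (tangent_vanish _ _ _ s0 iY iU)// expeR_ge0.
have Up : 0 < hnorm P U by rewrite lt_def U0 hnorm_ge0.
have [Dp [h [hg hI _]]] := tangent_growth _ _ _ s0 iY iU _ st Up.
rewrite -[X in (X%:E <= _)%E](lnK Dp) -[(expR _)%:E]/(expeR _%:E) lee_expeR.
apply: (@le_trans _ _ (ln (hnorm P (Dpsi s t Y U)) - ln (hnorm P U))%:E).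
  by rewrite lee_fin lerDl oppr_ge0 ln_le0.
rewrite -hI; apply: integral_le_any => u /=; rewrite in_itv/= => sut.
by have [] := hg u sut.
Qed.

Lemma exists_unit_vector s : (1 <= d)%N -> 0 <= s ->
  exists2 U : Omega -> Rd, inH P F s U & hnorm P U = 1.
Proof.
move=> d1 s0; pose e : Rd := delta_mx 0 (Ordinal d1); have [sF _] := hF.1 s s0.
have ee : dotv e e = 1.
  rewrite dotvE (bigD1 (Ordinal d1))//= big1 ?addr0 ?mxE ?eqxx ?mulr1// => i /negbTE i0.
  by rewrite mxE eqxx i0 mul0r.
exists (fun=> e).
  split.
    by rewrite -(measurable_TG _ sF); apply: coord_measurable_wrt => i; exact: measurable_cst.
  by rewrite enorm_sqr ee integral_cst_prob ltry.
by rewrite /hnorm /hdot Rintegral_cst//= ee probability_setT mulr1 sqrtr1.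
Qed.

Lemma lne_opnorm_upper s t Y : 0 <= s -> s <= t -> inH P F s Y ->
  (lne (opnorm P F s (Dpsi s t Y)) <=
   \int[lebesgue_measure]_(u in `[s, t]) gamma P F u (dB P F b u (psi P X s u Y)))%E.
Proof.
move=> s0 st iY; have le_op := opnorm_upper _ _ _ s0 st iY.
have [op0|op0] := leP (opnorm P F s (Dpsi s t Y)) 0%E.
  by rewrite le0_lneNy// leNye.
rewrite -[leRHS]expeRK lee_lne// in_itv/= ?leey ?andbT; first exact: ltW.
exact: expeR_ge0.
Qed.

(** One vector of norm one suffices, and a constant one lies in every [H_s]. *)
Lemma lne_opnorm_lower s t Y : (1 <= d)%N -> 0 <= s -> s <= t -> inH P F s Y ->
  (- (\int[lebesgue_measure]_(u in `[s, t])
        gamma P F u (opopp (dB P F b u (psi P X s u Y))))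
   <= lne (opnorm P F s (Dpsi s t Y)))%E.
Proof.
move=> d1 s0 st iY; have [U iU U1] := exists_unit_vector s d1 s0.
have U0 : 0 < hnorm P U by rewrite U1.
have [Dp [h [hg _ hI]]] := tangent_growth _ _ _ s0 iY iU _ st U0.
have op : ((hnorm P (Dpsi s t Y U))%:E <= opnorm P F s (Dpsi s t Y))%E.
  by apply: ereal_sup_ubound; exists U => //; rewrite /= U1.
apply: (@le_trans _ _ (ln (hnorm P (Dpsi s t Y U)))%:E); last first.
  rewrite -lne_EFin// lee_lne// in_itv/= leey andbT ?lee_fin ?hnorm_ge0//.
  by apply: le_trans op; rewrite lee_fin hnorm_ge0.
rewrite leeNl -EFinN -[X in (- X)%:E]subr0 -[X in _ - X](ln1 R) -U1 -hI.
apply: integral_le_any => u /=; rewrite in_itv/= => sut.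
by have [] := hg u sut.
Qed.

End flow_tangent.

Theorem theorem2p1 (R : realType) (d : nat) (d_ge1 : (1 <= d)%N)
    (dO : measure_display) (Omega : measurableType dO) (P : probability Omega R)
    (F : R -> set (set Omega)) (W : R -> Omega -> 'rV[R]_d)
    (b : R -> 'rV[R]_d * 'rV[R]_d -> 'rV[R]_d)
    (X : R -> R -> probability (borel_rV R d) R -> 'rV[R]_d -> Omega -> 'rV[R]_d)
    (phi : R -> R -> probability (borel_rV R d) R -> probability (borel_rV R d) R)
    (Dpsi : R -> R -> (Omega -> 'rV[R]_d) -> (Omega -> 'rV[R]_d) -> (Omega -> 'rV[R]_d))
    (hF : filtration F)
    (hW : brownian_motion P F W)
    (hI : contains_independent_variables P F W)
    (hb : smooth_bounded_derivatives b)
    (hX : mckean_vlasov_flow P F b W X phi)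
    (hD : tangent_process P F b X Dpsi) :
  [/\ forall (s t : R) (Y : Omega -> 'rV[R]_d), 0 <= s -> s <= t -> inH P F s Y ->
        (- (\int[lebesgue_measure]_(u in `[s, t])
              gamma P F u (opopp (dB P F b u (psi P X s u Y))))
           <= lne (opnorm P F s (Dpsi s t Y)))%E /\
        (lne (opnorm P F s (Dpsi s t Y))
           <= \int[lebesgue_measure]_(u in `[s, t])
                gamma P F u (dB P F b u (psi P X s u Y)))%E,
      forall lambda0 : R, condH b lambda0 ->
        forall (t : R) (Y : Omega -> 'rV[R]_d), 0 <= t -> inH P F t Y ->
          (gamma P F t (dB P F b t Y) <= (- lambda0)%:E)%E &
      forall lambda0 : R, 0 < lambda0 ->
        (forall (t : R) (Y : Omega -> 'rV[R]_d), 0 <= t -> inH P F t Y ->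
           (gamma P F t (dB P F b t Y) <= (- lambda0)%:E)%E) ->
        forall (s t : R) (Y : Omega -> 'rV[R]_d), 0 <= s -> s <= t -> inH P F s Y ->
          (lne (opnorm P F s (Dpsi s t Y)) <= (- lambda0 * (t - s))%:E)%E].
Proof.
have upper := lne_opnorm_upper P F W b X phi Dpsi hF hb hX hD.
split.
- move=> s t Y s0 st iY; split; last exact: upper.
  exact: (lne_opnorm_lower P F W b X phi Dpsi hF hb hX hD).
- move=> lambda0 hH t Y t0 iY.
  exact: (condH_gamma P F b hF hb lambda0 t Y hH t0 iY.1).
- move=> lambda0 _ hgamma s t Y s0 st iY.
  apply: le_trans (upper s t Y s0 st iY) _.
  apply: (@le_trans _ _ (\int[lebesgue_measure]_(u in `[s, t]) (- lambda0)%:E)%E).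
    apply: integral_le_any => u /=; rewrite in_itv/= => /andP[su ut].
    have u0 := le_trans s0 su.
    apply: (truncation_gamma P F b hF hb) => //; first by move=> Z; exact: hgamma.
    exact: (psi_measurable P F W b X phi hF hX).
  rewrite integral_cst//= lebesgue_measure_itv/= lte_fin.
  move: st; rewrite le_eqVlt => /predU1P[->|st]; first by rewrite ltxx mule0 subrr mulr0.
  by rewrite st -EFinD -EFinM.
Qed.
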